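(* Let $B=\bigoplus_{\alpha\in\mathbb{Z}}\mathbb{C}[\partial]L_\alpha(w)$ be the Lie conformal algebra with $[L_\alpha(w)_\lambda L_\beta(w)]=(\alpha\partial+(\alpha+\beta)\lambda)L_{\alpha+\beta}(w)$. Any nontrivial (conformal) free intermediate series $B$-module is isomorphic, as a $B$-module, to one of the following modules, where $C,D\in\mathbb{C}$ are constants, each module is $\bigoplus_{\gamma\in\mathbb{Z}}\mathbb{C}[\partial]v_\gamma$ (free over $\mathbb{C}[\partial]$ on the $v_\gamma$), and the action is given on basis elements for $\alpha,\gamma\in\mathbb{Z}$: (1) $V_{C,D}$: $L_\alpha(w)_\lambda v_\gamma=((\alpha+\gamma+C)\lambda+\alpha(\partial+D))v_{\alpha+\gamma}$; (2) $V_D$: $$L_\alpha(w)_\lambda v_\gamma=\begin{cases}((\alpha+\gamma)\lambda+\alpha(\partial+D))v_{\alpha+\gamma}&\text{if }\gamma\neq0\text{ and }\alpha+\gamma\neq0,\\ \alpha(\lambda+\partial+D)^2v_{\alpha+\gamma}&\text{if }\gamma=0,\\ \alpha\,v_{\alpha+\gamma}&\text{if }\alpha+\gamma=0;\end{cases}$$ (3) $V'_D$: $$L_\alpha(w)_\lambda v_\gamma=\begin{cases}((\alpha+\gamma)\lambda+\alpha(\partial+D))v_{\alpha+\gamma}&\text{if }\gamma\neq0\text{ and }\alpha+\gamma\neq0,\\ \alpha\,v_{\alpha+\gamma}&\text{if }\gamma=0,\\ \alpha(\partial+D)^2v_{\alpha+\gamma}&\text{if }\alpha+\gamma=0.\e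nd{cases}$$
   Context: The bracket of $B$ is extended from the basis by $[\partial a_\lambda b]=-\lambda[a_\lambda b]$, $[a_\lambda\partial b]=(\partial+\lambda)[a_\lambda b]$. $B$ is $\mathbb{Z}$-graded with $B_\alpha=\mathbb{C}[\partial]L_\alpha(w)$. A conformal $B$-module is a $\mathbb{C}[\partial]$-module $V$ with a $\mathbb{C}$-bilinear $\lambda$-action $B\times V\to V[\lambda]$, $(a,v)\mapsto a_\lambda v$, such that for all $a,b\in B$, $v\in V$: $[a_\lambda b]_{\lambda+\mu}v=a_\lambda(b_\mu v)-b_\mu(a_\lambda v)$, $(\partial a)_\lambda v=-\lambda a_\lambda v$, $a_\lambda(\partial v)=(\partial+\lambda)a_\lambda v$. It is $\mathbb{Z}$-graded if $V=\bigoplus_{\gamma\in\mathbb{Z}}V_\gamma$ as a $\mathbb{C}[\partial]$-module with $(B_\alpha)_\lambda V_\gamma\subset V_{\alpha+\gamma}[\lambda]$ for all $\alpha,\gamma$. A free intermediate series module is a $\mathbb{Z}$-graded module in which each $V_\gamma$ is freely generated over $\mathbb{C}[\partial]$ by a single element $v_\gamma\in V_\gamma$. A module is trivial if $a_\lambda v=0$ for all $a\in B,v\in V$. An isomorphism of $B$-modules is a $\mathbb{C}[\partial]$-module isomorphism commuting with the $\lambda$-action (it need not preserve the grading index). In (2) and (3), for $\alpha=\gamma=0$ the two overlapping cases both give $0$. The actions on basis elements are extended to all of $B$ and $V$ by $(\partial a)_\lambda v=-\lambda a_\lambda v$ and $a_\lambda(\partial v)=(\partial+\lambda)a_\lambda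 v$. *)

(* Defs.v *)
From mathcomp Require Import all_boot all_order all_algebra.
From mathcomp Require Import finmap complex reals monalg ring zify.

Set Implicit Arguments.
Unset Strict Implicit.
Unset Printing Implicit Defensive.

Import GRing.Theory.
Local Open Scope ring_scope.

(* A K[d]-module is an [lmodType {poly K}], the derivation d acting as
   ['X *: _].  The space M[lambda] of polynomials in lambda with coefficients
   in M is the type of finitely supported families nat -> M:
   [p@_n] is the coefficient of lambda^n. *)
Definition lpoly (M : zmodType) := {malg M[nat]}.

(* The coefficient of lambda^n in lambda * p. *)
Definition lambda_shift (M : zmodType) (p : lpoly M) (n : nat) : M :=
  if n is n'.+1 then p@_n' else 0.

Section Conformal.
Variable K : fieldType.

Record is_lambda_product (A V : lmodType {poly K}) (act : A -> V -> lpoly V)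
    : Prop := IsLambdaProduct {
  lprodDl : forall a b v, act (a + b) v = act a v + act b v;
  lprodDr : forall a v w, act a (v + w) = act a v + act a w;
  lprodCl : forall (c : K) a v n,
    (act (c%:P *: a) v)@_n = c%:P *: (act a v)@_n;
  lprodCr : forall (c : K) a v n,
    (act a (c%:P *: v))@_n = c%:P *: (act a v)@_n;
  (* (d a)_lambda v = - lambda a_lambda v *)
  lprodXl : forall a v n, (act ('X *: a) v)@_n = - lambda_shift (act a v) n;
  (* a_lambda (d v) = (d + lambda) (a_lambda v) *)
  lprodXr : forall a v n,
    (act a ('X *: v))@_n = 'X *: (act a v)@_n + lambda_shift (act a v) n
}.

(* The coefficient of lambda^m mu^n in the identity
     [a_lambda b]_(lambda + mu) v = a_lambda (b_mu v) - b_mu (a_lambda v).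
   With [a_lambda b] = \sum_k lambda^k c_k, the left-hand side is
     \sum_(k, j) lambda^k (lambda + mu)^j ((c_k)_lambda v)@_j. *)
Definition lambda_jacobi (A V : lmodType {poly K})
    (brk : A -> A -> lpoly A) (act : A -> V -> lpoly V) : Prop :=
  forall (a b : A) (v : V) (m n : nat),
    \sum_(0 <= k < m.+1) (act (brk a b)@_k v)@_(m - k + n)%N *+ 'C(m - k + n, n)
    = (act a (act b v)@_n)@_m - (act b (act a v)@_m)@_n.

(* The coefficient of lambda^n in [a_lambda b] = - [b_(- lambda - d) a]. *)
Definition lambda_skew (A : lmodType {poly K}) (brk : A -> A -> lpoly A)
    : Prop :=
  forall (a b : A) (n : nat),
    (brk a b)@_n = - \sum_(k <- msupp (brk b a))
      (((-1) ^+ k * 'X^(k - n)) *+ 'C(k, n)) *: (brk b a)@_k.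

Record lieConformalAlgebra := LieConformalAlgebra {
  lca_sort :> lmodType {poly K};
  lbracket : lca_sort -> lca_sort -> lpoly lca_sort;
  lbracket_product : is_lambda_product lbracket;
  lbracket_skew : lambda_skew lbracket;
  lbracket_jacobi : lambda_jacobi lbracket lbracket
}.

Record conformalModule (A : lieConformalAlgebra) := ConformalModule {
  cmod_sort :> lmodType {poly K};
  lact : A -> cmod_sort -> lpoly cmod_sort;
  lact_product : is_lambda_product lact;
  lact_jacobi : lambda_jacobi (@lbracket A) lact
}.

Definition trivial_module (A : lieConformalAlgebra) (V : conformalModule A)
    : Prop :=
  forall (a : A) (v : V), lact a v = 0.

Definition module_iso (A : lieConformalAlgebra) (V W : conformalModule A)
    : Prop :=
  exists phi : {linear V -> W},
    bijective phi /\
    forall (a : A) (v : V) (n : nat),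
      phi (lact a v)@_n = (lact a (phi v))@_n.

(* M is the internal direct sum of the K[d]-submodules (G i), i : int. *)
Record is_grading (M : lmodType {poly K}) (G : int -> M -> Prop) : Prop :=
  IsGrading {
  grading0 : forall i, G i 0;
  gradingD : forall i x y, G i x -> G i y -> G i (x + y);
  gradingZ : forall i (f : {poly K}) x, G i x -> G i (f *: x);
  grading_sum : forall x : M, exists (s : seq int) (y : int -> M),
    [/\ uniq s, forall i, G i (y i) & x = \sum_(i <- s) y i];
  grading_direct : forall (s : seq int) (y : int -> M),
    uniq s -> (forall i, G i (y i)) -> \sum_(i <- s) y i = 0 ->
    forall i, i \in s -> y i = 0
}.

End Conformal.

Section MalgSums.
Variables (I : choiceType) (G M : zmodType).
Implicit Types g : {malg G[I]}.

Lemma malg_ind (P : {malg G[I]} -> Prop) :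
  P 0 -> (forall g1 g2, P g1 -> P g2 -> P (g1 + g2)) ->
  (forall x i, P << x *g i >>) -> forall g, P g.
Proof.
move=> P0 PD PU g; rewrite (monalgE g).
by elim/big_ind: _ => // i _; apply: PU.
Qed.

Variable h : I -> G -> M.
Hypothesis hD : forall i x y, h i (x + y) = h i x + h i y.

Let h0 i : h i 0 = 0.
Proof. by apply: (addrI (h i 0)); rewrite -hD !addr0. Qed.

Lemma msum_widen g (s : seq I) : uniq s -> {subset msupp g <= s} ->
  \sum_(i <- msupp g) h i g@_i = \sum_(i <- s) h i g@_i.
Proof.
move=> us sub; rewrite [RHS](bigID (mem (msupp g))) /=.
rewrite [X in _ + X]big1 ?addr0; last first.
  by move=> i /mcoeff_outdom ->.
rewrite -[RHS]big_filter; apply: perm_big; apply: uniq_perm => //.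
  exact: filter_uniq.
move=> i; rewrite mem_filter; apply/idP/andP => [ig|[]//].
by split=> //; apply: sub.
Qed.

Lemma msumD g1 g2 :
  \sum_(i <- msupp (g1 + g2)) h i (g1 + g2)@_i =
  \sum_(i <- msupp g1) h i g1@_i + \sum_(i <- msupp g2) h i g2@_i.
Proof.
set s := undup (msupp (g1 + g2) ++ (msupp g1 ++ msupp g2)).
have us : uniq s by apply: undup_uniq.
rewrite (@msum_widen (g1 + g2) s) ?(@msum_widen g1 s) ?(@msum_widen g2 s) //;
  try by move=> i ig; rewrite mem_undup !mem_cat ig ?orbT.
by rewrite -big_split; apply: eq_bigr => i _; rewrite mcoeffD hD.
Qed.

Lemma msumU x i :
  \sum_(j <- msupp << x *g i >>) h j << x *g i >>@_j = h i x.
Proof.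
rewrite (@msum_widen _ [:: i]) ?big_seq1 ?mcoeffUU // => j.
rewrite -mcoeff_neq0 mcoeffU inE; case: (i =P j) => [->|_]; rewrite ?eqxx //.
Qed.

End MalgSums.

Section JacobiGenerators.
Variable X : zmodType.
Variables brk act : {malg X[int]} -> {malg X[int]} -> lpoly {malg X[int]}.
Hypothesis brkDl : forall a b v, brk (a + b) v = brk a v + brk b v.
Hypothesis brkDr : forall a v w, brk a (v + w) = brk a v + brk a w.
Hypothesis actDl : forall a b v, act (a + b) v = act a v + act b v.
Hypothesis actDr : forall a v w, act a (v + w) = act a v + act a w.

Let brk0l v : brk 0 v = 0.
Proof. by apply: (addrI (brk 0 v)); rewrite -brkDl !addr0. Qed.
Let brk0r v : brk v 0 = 0.
Proof. by apply: (addrI (brk v 0)); rewrite -brkDr !addr0. Qed.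
Let act0l v : act 0 v = 0.
Proof. by apply: (addrI (act 0 v)); rewrite -actDl !addr0. Qed.
Let act0r v : act v 0 = 0.
Proof. by apply: (addrI (act v 0)); rewrite -actDr !addr0. Qed.

Let jacobi a b v := forall m n,
  \sum_(0 <= k < m.+1) (act (brk a b)@_k v)@_(m - k + n)%N *+ 'C(m - k + n, n)
  = (act a (act b v)@_n)@_m - (act b (act a v)@_m)@_n.

Lemma jacobi_on_generators :
  (forall (f h g : X) (i j k : int),
     jacobi << f *g i >> << h *g j >> << g *g k >>) ->
  forall a b v, jacobi a b v.
Proof.
move=> gen a b v m n.
have dB (M : zmodType) (x y z t : M) : (x + y) - (z + t) = (x - z) + (y - t).
  by rewrite opprD addrACA.
have S0 (I : nat -> {malg X[int]}) : (forall k, I k = 0) ->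
    \sum_(0 <= k < m.+1) I k *+ 'C(m - k + n, n) = 0.
  by move=> I0; rewrite big1 // => k _; rewrite I0 mul0rn.
elim/malg_ind: a => [|a1 a2 IH1 IH2|f i].
- rewrite !act0l !brk0l !mcoeff0 act0r mcoeff0 subr0; apply: S0 => k.
  by rewrite !mcoeff0 act0l mcoeff0.
- rewrite !actDl !mcoeffD actDr mcoeffD dB -IH1 -IH2 -big_split.
  apply: eq_bigr => k _ /=.
  by rewrite brkDl mcoeffD actDl mcoeffD mulrnDl.
elim/malg_ind: b => [|b1 b2 IH1 IH2|h j].
- rewrite !act0l !brk0r !mcoeff0 act0r mcoeff0 subr0; apply: S0 => k.
  by rewrite !mcoeff0 act0l mcoeff0.
- rewrite !actDl !mcoeffD actDr mcoeffD dB -IH1 -IH2 -big_split.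
  apply: eq_bigr => k _ /=.
  by rewrite brkDr mcoeffD actDl mcoeffD mulrnDl.
elim/malg_ind: v => [|v1 v2 IH1 IH2|g k]; last exact: gen.
- rewrite !act0r !mcoeff0 !act0r !mcoeff0 subr0; apply: S0 => k.
  by rewrite act0r mcoeff0.
- rewrite !actDr !mcoeffD !actDr !mcoeffD dB -IH1 -IH2 -big_split.
  apply: eq_bigr => k _ /=.
  by rewrite actDr mcoeffD mulrnDl.
Qed.

End JacobiGenerators.

Section GradedProducts.
Variable K : fieldType.

(* The free K[d]-module with basis (<< i >>), i : int. *)
Definition freeZ := {malg {poly K}[int]}.

(* In the ring {poly {poly K}} = K[d][lambda]: *)
Definition lamP : {poly {poly K}} := 'X.
Definition derP : {poly {poly K}} := 'X%:P.
Definition cstP (c : K) : {poly {poly K}} := c%:P%:P.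

(* q(lambda, d) u_i as an element of freeZ[lambda] *)
Definition basis_lpoly (i : int) (q : {poly {poly K}}) : lpoly freeZ :=
  \sum_(n < size q) << << q`_n *g i >> *g (n : nat) >>.

(* f(-lambda) g(d + lambda) *)
Definition twist (f g : {poly K}) : {poly {poly K}} :=
  (f ^:P \Po (- lamP)) * (g ^:P \Po (derP + lamP)).

(* The extension to freeZ, by
     (f(d) u_i)_lambda (g(d) u_j) = f(-lambda) g(d + lambda) (u_i_lambda u_j),
   of the lambda-product u_i_lambda u_j = p_(i,j)(lambda, d) u_(i+j). *)
Definition graded_product (p : int -> int -> {poly {poly K}})
    (a v : freeZ) : lpoly freeZ :=
  \sum_(i <- msupp a) \sum_(j <- msupp v)
    basis_lpoly (i + j) (twist a@_i v@_j * p i j).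

Section Theory.
Variable p : int -> int -> {poly {poly K}}.

Lemma basis_lpolyE i q n : (basis_lpoly i q)@_n = << q`_n *g i >>.
Proof.
rewrite /basis_lpoly raddf_sum /=.
under eq_bigr do rewrite mcoeffU.
have [nq|nq] := ltnP n (size q).
  rewrite (bigD1 (Ordinal nq)) //= eqxx mulr1n big1 ?addr0 // => j jn.
  by rewrite (_ : (j == n :> nat) = false) //; apply: negbTE.
rewrite nth_default // raddf0 big1 // => j _.
rewrite (_ : (j == n :> nat) = false) //; apply/eqP => jn.
by move: (ltn_ord j); rewrite jn ltnNge nq.
Qed.

Lemma basis_lpolyD i q r :
  basis_lpoly i (q + r) = basis_lpoly i q + basis_lpoly i r.
Proof.
by apply/malgP => n; rewrite mcoeffD !basis_lpolyE coefD raddfD.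
Qed.

Lemma basis_lpoly0 i : basis_lpoly i 0 = 0.
Proof. by apply/malgP => n; rewrite mcoeff0 basis_lpolyE coef0 raddf0. Qed.

Lemma twistDl f1 f2 g : twist (f1 + f2) g = twist f1 g + twist f2 g.
Proof. by rewrite /twist rmorphD /= comp_polyD mulrDl. Qed.

Lemma twistDr f g1 g2 : twist f (g1 + g2) = twist f g1 + twist f g2.
Proof. by rewrite /twist rmorphD /= comp_polyD mulrDr. Qed.

Local Notation act := (graded_product p).

Lemma graded_productDl a b v : act (a + b) v = act a v + act b v.
Proof.
rewrite /graded_product.
pose h i (f : {poly K}) := \sum_(j <- msupp v)
  basis_lpoly (i + j) (twist f v@_j * p i j).
apply: (@msumD _ _ _ h) => i f g; rewrite /h -big_split.
by apply: eq_bigr => j _; rewrite twistDl mulrDl basis_lpolyD.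
Qed.

Lemma graded_productDr a v w : act a (v + w) = act a v + act a w.
Proof.
rewrite /graded_product -big_split; apply: eq_bigr => i _ /=.
pose h j (g : {poly K}) := basis_lpoly (i + j) (twist a@_i g * p i j).
by apply: (@msumD _ _ _ h) => j f g; rewrite /h twistDr mulrDl basis_lpolyD.
Qed.

Lemma graded_productU f g i j :
  act << f *g i >> << g *g j >> = basis_lpoly (i + j) (twist f g * p i j).
Proof.
rewrite /graded_product.
pose h i (f : {poly K}) := \sum_(k <- msupp << g *g j >>)
  basis_lpoly (i + k) (twist f << g *g j >>@_k * p i k).
rewrite (@msumU _ _ _ h) => [|{}i f1 f2]; last first.
  rewrite /h -big_split; apply: eq_bigr => k _.
  by rewrite twistDl mulrDl basis_lpolyD.
rewrite /h.
pose h' k (g : {poly K}) := basis_lpoly (i + k) (twist f g * p i k).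
rewrite (@msumU _ _ _ h') // => k g1 g2.
by rewrite /h' twistDr mulrDl basis_lpolyD.
Qed.

Lemma graded_productE i j n :
  (act << i >> << j >>)@_n = << (p i j)`_n *g i + j >>.
Proof.
by rewrite graded_productU basis_lpolyE /twist !rmorph1 !mul1r.
Qed.

Lemma graded_product0l v : act 0 v = 0.
Proof. by apply: (addrI (act 0 v)); rewrite -graded_productDl !addr0. Qed.

Lemma graded_product0r a : act a 0 = 0.
Proof. by apply: (addrI (act a 0)); rewrite -graded_productDr !addr0. Qed.

Lemma freeZ_scaleU (f g : {poly K}) i :
  f *: << g *g i >> = << f * g *g i >> :> freeZ.
Proof. by apply/malgP => k; rewrite mcoeffZ !mcoeffU mulrnAr. Qed.

Lemma lambda_shiftD (M : zmodType) (x y : lpoly M) n :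
  lambda_shift (x + y) n = lambda_shift x n + lambda_shift y n.
Proof. by case: n => [|n]; rewrite /lambda_shift ?addr0 ?mcoeffD. Qed.

Lemma lambda_shift0 (M : zmodType) n : lambda_shift (0 : lpoly M) n = 0.
Proof. by case: n => [|n]; rewrite /lambda_shift ?mcoeff0. Qed.

Lemma twistCl c f g : twist (c%:P * f) g = cstP c * twist f g.
Proof.
by rewrite /twist rmorphM /= rmorphM /= map_polyC comp_polyC -mulrA.
Qed.

Lemma twistCr c f g : twist f (c%:P * g) = cstP c * twist f g.
Proof.
by rewrite /twist rmorphM /= rmorphM /= map_polyC comp_polyC mulrCA.
Qed.

Lemma twistXl f g : twist ('X * f) g = - (lamP * twist f g).
Proof.
by rewrite /twist rmorphM /= rmorphM /= map_polyX comp_polyX -mulrA mulNr.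
Qed.

Lemma twistXr f g : twist f ('X * g) = (derP + lamP) * twist f g.
Proof.
by rewrite /twist rmorphM /= rmorphM /= map_polyX comp_polyX mulrCA.
Qed.

Local Opaque graded_product basis_lpoly.

Lemma graded_product_is_lambda_product : is_lambda_product act.
Proof.
split; [exact: graded_productDl | exact: graded_productDr | | | | ].
- move=> c a v n; elim/malg_ind: a => [|a b IHa IHb|f i].
  + by rewrite scaler0 graded_product0l mcoeff0 scaler0.
  + rewrite scalerDr (graded_productDl (_ *: _)) (graded_productDl a)
      [X in X = _]mcoeffD [in RHS]mcoeffD.
    rewrite [in RHS]scalerDr.
    exact (f_equal2 +%R IHa IHb).
  elim/malg_ind: v => [|v w IHv IHw|g j].
  + by rewrite !graded_product0r mcoeff0 scaler0.
  + rewrite !(graded_productDr _ v)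
      [X in X = _]mcoeffD [in RHS]mcoeffD [in RHS]scalerDr.
    exact (f_equal2 +%R IHv IHw).
  by rewrite !freeZ_scaleU !graded_productU !basis_lpolyE !freeZ_scaleU
             twistCl -mulrA coefCM.
- move=> c a v n; elim/malg_ind: a => [|a b IHa IHb|f i].
  + by rewrite !graded_product0l mcoeff0 scaler0.
  + rewrite !(graded_productDl a)
      [X in X = _]mcoeffD [in RHS]mcoeffD [in RHS]scalerDr.
    exact (f_equal2 +%R IHa IHb).
  elim/malg_ind: v => [|v w IHv IHw|g j].
  + by rewrite scaler0 !graded_product0r mcoeff0 scaler0.
  + rewrite scalerDr (graded_productDr _ (_ *: _)) (graded_productDr _ v)
      [X in X = _]mcoeffD [in RHS]mcoeffD.
    rewrite [in RHS]scalerDr.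
    exact (f_equal2 +%R IHv IHw).
  by rewrite !freeZ_scaleU !graded_productU !basis_lpolyE !freeZ_scaleU
             twistCr -mulrA coefCM.
- move=> a v n; elim/malg_ind: a => [|a b IHa IHb|f i].
  + by rewrite scaler0 graded_product0l lambda_shift0 mcoeff0 oppr0.
  + rewrite scalerDr (graded_productDl (_ *: _)) (graded_productDl a).
    rewrite [X in X = _]mcoeffD.
    rewrite lambda_shiftD opprD.
    exact (f_equal2 +%R IHa IHb).
  elim/malg_ind: v => [|v w IHv IHw|g j].
  + by rewrite !graded_product0r lambda_shift0 mcoeff0 oppr0.
  + rewrite !(graded_productDr _ v) [X in X = _]mcoeffD lambda_shiftD opprD.
    exact (f_equal2 +%R IHv IHw).
  rewrite freeZ_scaleU !graded_productU basis_lpolyE twistXl mulNr coefN.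
  rewrite -mulrA coefXM raddfN /= /lambda_shift; case: n => [|n] /=.
    by rewrite raddf0.
  by rewrite basis_lpolyE.
- move=> a v n; elim/malg_ind: a => [|a b IHa IHb|f i].
  + by rewrite !graded_product0l lambda_shift0 mcoeff0 scaler0 addr0.
  + rewrite !(graded_productDl a)
      [X in X = _]mcoeffD [in RHS]mcoeffD lambda_shiftD [in RHS]scalerDr addrACA.
    exact (f_equal2 +%R IHa IHb).
  elim/malg_ind: v => [|v w IHv IHw|g j].
  + by rewrite scaler0 !graded_product0r lambda_shift0 mcoeff0 scaler0 addr0.
  + rewrite scalerDr (graded_productDr _ (_ *: _)) (graded_productDr _ v)
      [X in X = _]mcoeffD [in RHS]mcoeffD.
    rewrite lambda_shiftD [in RHS]scalerDr addrACA.
    exact (f_equal2 +%R IHv IHw).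
  rewrite freeZ_scaleU !graded_productU !basis_lpolyE twistXr.
  rewrite freeZ_scaleU -mulrA mulrDl coefD coefCM coefXM raddfD /=.
  by congr (_ + _); case: n => [|n] /=; rewrite ?raddf0 ?basis_lpolyE.
Qed.

End Theory.
(* P3 = K[d][lambda][mu]; ev d l q is q with d and l substituted for the
   derivation and for lambda. *)
Definition P3 : comNzRingType := {poly {poly {poly K}}}.
Definition cst3 : {rmorphism K -> P3} :=
  (polyC : {rmorphism {poly {poly K}} -> P3}) \o
  ((polyC : {rmorphism {poly K} -> {poly {poly K}}}) \o
   (polyC : {rmorphism K -> {poly K}})).
Definition ev1 (d : P3) : {rmorphism {poly K} -> P3} :=
  horner_eval d \o map_poly cst3.
Definition ev (d l : P3) : {rmorphism {poly {poly K}} -> P3} :=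
  horner_eval l \o map_poly (ev1 d).

Definition dd : P3 := 'X%:P%:P.
Definition ll : P3 := 'X%:P.
Definition mm : P3 := 'X.

Lemma ev1_ext (S : comNzRingType) (F G : {rmorphism {poly K} -> S}) :
  (forall c, F c%:P = G c%:P) -> F 'X = G 'X -> F =1 G.
Proof.
move=> Fc FX f; rewrite -[f]coefK poly_def !rmorph_sum /=.
apply: eq_bigr => i _; rewrite -mul_polyC !rmorphM !rmorphXn /=.
by rewrite Fc FX.
Qed.

Lemma ev_ext (S : comNzRingType) (F G : {rmorphism {poly {poly K}} -> S}) :
  (forall c, F (cstP c) = G (cstP c)) -> F derP = G derP ->
  F lamP = G lamP -> F =1 G.
Proof.
move=> Fc Fd Fl f; rewrite -[f]coefK poly_def !rmorph_sum /=.
apply: eq_bigr => i _; rewrite -mul_polyC !rmorphM !rmorphXn /= Fl.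
congr (_ * _).
exact: (@ev1_ext _ (F \o polyC) (G \o polyC)).
Qed.

Lemma ev1C d c : ev1 d c%:P = cst3 c.
Proof. by rewrite /ev1 /= /horner_eval (map_polyC cst3) hornerC. Qed.
Lemma ev1X d : ev1 d 'X = d.
Proof. by rewrite /ev1 /= /horner_eval (map_polyX cst3) hornerX. Qed.
Lemma evP d l f : ev d l f%:P = ev1 d f.
Proof. by rewrite /ev /= /horner_eval (map_polyC (ev1 d)) hornerC. Qed.
Lemma evC d l c : ev d l (cstP c) = cst3 c.
Proof. by rewrite evP ev1C. Qed.
Lemma evd d l : ev d l derP = d.
Proof. by rewrite evP ev1X. Qed.
Lemma evl d l : ev d l lamP = l.
Proof. by rewrite /ev /= /horner_eval (map_polyX (ev1 d)) hornerX. Qed.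

Lemma evE d l q : ev d l q = \sum_(k < size q) ev1 d q`_k * l ^+ k.
Proof.
rewrite -{1}[q]coefK poly_def rmorph_sum; apply: eq_bigr => k _.
by rewrite -mul_polyC rmorphM rmorphXn evP -[in RHS](evl d l).
Qed.

Lemma ev_comp d l f (r : {poly {poly K}}) :
  ev d l (f ^:P \Po r) = ev1 (ev d l r) f.
Proof.
pose F : {rmorphism {poly K} -> P3} :=
  ev d l \o (comp_poly r \o map_poly polyC).
rewrite -[LHS]/(F f).
apply: (@ev1_ext _ F) => [c|].
  by rewrite -[LHS]/(ev d l (c%:P ^:P \Po r)) map_polyC comp_polyC evC ev1C.
by rewrite -[LHS]/(ev d l ('X ^:P \Po r)) map_polyX comp_polyX ev1X.
Qed.

Lemma ev_twist d l f g : ev d l (twist f g) = ev1 (- l) f * ev1 (d + l) g.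
Proof. by rewrite rmorphM !ev_comp rmorphN rmorphD evd evl. Qed.

Lemma ev_dl q : ev dd ll q = q%:P.
Proof.
apply: (@ev_ext _ _ (polyC : {rmorphism _ -> P3})) => [c||];
by rewrite ?evC ?evd ?evl.
Qed.

Lemma ev_dm q : ev dd mm q = q ^:P.
Proof.
pose C1 : {rmorphism {poly K} -> {poly {poly K}}} := polyC.
apply: (@ev_ext _ _ (map_poly C1)) => [c||].
- by rewrite evC [RHS]map_polyC.
- by rewrite evd [RHS]map_polyC.
- by rewrite evl [RHS]map_polyX.
Qed.

Lemma twist0r f : twist f 0 = 0.
Proof. by rewrite /twist !rmorph0 mulr0. Qed.

Lemma twist0l g : twist 0 g = 0.
Proof. by rewrite /twist !rmorph0 mul0r. Qed.

Lemma coef_act_lm f (Q r : {poly {poly K}}) m n :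
  (twist f Q`_n * r)`_m =
  (ev1 (- ll) f * ev dd ll r * ev (dd + ll) mm Q)`_n`_m.
Proof.
rewrite (evE _ _ Q) big_distrr /=.
rewrite (eq_bigr (fun k : 'I__ => (twist f Q`_k * r) *: 'X^k)); last first.
  move=> k _; rewrite -mul_polyC -ev_dl [ev _ _ (_ * _)]rmorphM ev_twist.
  by rewrite mulrA; congr (_ * _); rewrite mulrAC.
rewrite -[\sum_(_ < _) _](poly_def (size Q) (fun k => twist f Q`_k * r)).
rewrite coef_poly; case: ltnP => // nQ.
by rewrite (nth_default _ nQ) twist0r mul0r.
Qed.

Lemma coef_act_ml h (Q r : {poly {poly K}}) m n :
  (twist h Q`_m * r)`_n =
  (ev1 (- mm) h * ev dd mm r * ev (dd + mm) ll Q)`_n`_m.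
Proof.
rewrite (evE _ _ Q) big_distrr /= !coef_sum.
rewrite (eq_bigr (fun k : 'I__ => (twist h Q`_k * r)`_n *+ (k == m :> nat))).
  have [mQ|mQ] := ltnP m (size Q); last first.
    rewrite (nth_default _ mQ) twist0r mul0r coef0 big1 // => k _.
    rewrite (_ : _ == _ = false) //; apply/eqP => km.
    by move: (ltn_ord k); rewrite km ltnNge mQ.
  rewrite (bigD1 (Ordinal mQ)) //= eqxx mulr1n big1 ?addr0 // => k.
  by rewrite -val_eqE /= => /negPf ->.
move=> k _; rewrite mulrA.
have -> : ev1 (- mm) h * ev dd mm r * ev1 (dd + mm) Q`_k =
          (twist h Q`_k * r) ^:P.
  by rewrite -ev_dm [ev _ _ (_ * _)]rmorphM ev_twist mulrAC.
rewrite /ll -rmorphXn coefMC coef_map /= coefCM coefXn eq_sym.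
by case: eqP; rewrite ?mulr1 ?mulr0.
Qed.

Lemma coef_binomial k j m n :
  ((ll ^+ k * (ll + mm) ^+ j)`_n)`_m =
  (if (n <= j)%N && (k + (j - n) == m)%N then 'C(j, n)%:R else 0) :> {poly K}.
Proof.
rewrite exprDn mulr_sumr !coef_sum.
under eq_bigr => i _.
  rewrite mulrnAr mulrA -exprD /ll /mm -rmorphXn /= coefMn coefCM coefXn.
  rewrite mulr_natr -mulrnA coefMn coefXn.
  over.
have [nj|nj] := leqP n j; last first.
  by rewrite big1 // => i _; rewrite (_ : (n == i)%N = false) ?mul0n ?mulr0n //;
     apply/eqP => ni; move: (ltn_ord i); rewrite -ni ltnS leqNgt nj.
rewrite (bigD1 (Ordinal (nj : n < j.+1)%N)) //= eqxx mul1n big1 ?addr0 => [|i].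
  by rewrite eq_sym; case: eqP => _; rewrite ?mul0rn.
by rewrite -val_eqE /= eq_sym => /negPf ->; rewrite mul0n mulr0n.
Qed.

Lemma ev1_dd c : ev1 dd c = c%:P%:P.
Proof. by rewrite -(evP dd ll) ev_dl. Qed.

Lemma coef_act_bracket g (Q r : {poly {poly K}}) m n :
  \sum_(0 <= k < m.+1) (twist Q`_k g * r)`_(m - k + n) *+ 'C(m - k + n, n) =
  (ev (- (ll + mm)) ll Q * ev1 (dd + (ll + mm)) g * ev dd (ll + mm) r)`_n`_m.
Proof.
pose E k := twist Q`_k g * r.
have -> : ev (- (ll + mm)) ll Q * ev1 (dd + (ll + mm)) g * ev dd (ll + mm) r =
  \sum_(k < size Q) \sum_(j < size (E k)) ((E k)`_j)%:P%:P *
     (ll ^+ k * (ll + mm) ^+ j).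
  rewrite (evE _ _ Q) !big_distrl; apply: eq_bigr => k _ /=.
  transitivity (ll ^+ k * ev dd (ll + mm) (E k)).
    by rewrite rmorphM ev_twist; ring.
  rewrite (evE _ _ (E k)) mulr_sumr; apply: eq_bigr => j _.
  by rewrite ev1_dd mulrCA.
rewrite !coef_sum.
have term (k : nat) : (\sum_(j < size (E k)) ((E k)`_j)%:P%:P *
     (ll ^+ k * (ll + mm) ^+ j))`_n`_m =
  if (k <= m)%N then (E k)`_(m - k + n) *+ 'C(m - k + n, n) else 0.
  rewrite !coef_sum.
  under eq_bigr do rewrite !coefCM coef_binomial.
  have [km|km] := leqP k m; last first.
    rewrite big1 // => j _; case: andP => [[_ /eqP jm]|]; last by rewrite mulr0.
    by move: km; rewrite -jm ltnNge leq_addr.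
  have [sE|sE] := ltnP (m - k + n) (size (E k)); last first.
    rewrite (nth_default _ sE) mul0rn big1 // => j _.
    case: andP => [[nj /eqP jm]|]; last by rewrite mulr0.
    by move: (ltn_ord j) sE nj jm; lia.
  rewrite (bigD1 (Ordinal sE)) //= leq_addl addnK subnKC // eqxx /= mulr_natr.
  rewrite big1 ?addr0 // => j; rewrite -val_eqE /= => jn.
  case: andP => [[nj /eqP jm]|]; last by rewrite mulr0.
  by move: jn nj jm; lia.
under [RHS]eq_bigr do rewrite term.
rewrite big_mkord.
pose M := maxn m.+1 (size Q).
pose G k := if (k <= m)%N then (E k)`_(m - k + n) *+ 'C(m - k + n, n) else 0.
rewrite (eq_bigr (fun k : 'I__ => G k)); last first.
  by move=> k _; rewrite /G -ltnS ltn_ord.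
rewrite -(big_mkord xpredT G) -(big_mkord xpredT G).
have widen s : (s <= M)%N -> (forall k, (s <= k)%N -> G k = 0) ->
    \sum_(0 <= k < s) G k = \sum_(0 <= k < M) G k.
  move=> sM G0; rewrite [RHS](big_cat_nat _ sM) //=.
  rewrite [X in _ + X]big_nat_cond [X in _ + X]big1 ?addr0 // => k.
  by case/andP => /andP [sk _] _; apply: G0.
rewrite !widen ?leq_maxl ?leq_maxr // => k sk; rewrite /G.
  by case: leqP => // _;
     rewrite /E (nth_default _ sk) twist0l mul0r coef0 mul0rn.
by rewrite leqNgt sk.
Qed.

Lemma graded_product_jacobi (pB p : int -> int -> {poly {poly K}}) :
  (forall i j k,
     ev (- (ll + mm)) ll (pB i j) * ev dd (ll + mm) (p (i + j) k) =
     ev dd ll (p i (j + k)) * ev (dd + ll) mm (p j k) -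
     ev dd mm (p j (i + k)) * ev (dd + mm) ll (p i k)) ->
  lambda_jacobi (graded_product pB) (graded_product p).
Proof.
move=> Hp;
apply: (@jacobi_on_generators _ (graded_product pB) (graded_product p)).
- exact: graded_productDl.
- exact: graded_productDr.
- exact: graded_productDl.
- exact: graded_productDr.
move=> f h g i j k m n.
rewrite !graded_productU !basis_lpolyE !graded_productU !basis_lpolyE.
rewrite (addrCA j i k) !addrA.
rewrite coef_act_lm coef_act_ml -raddfB -!coefB.
under eq_bigr => l _.
  rewrite basis_lpolyE graded_productU basis_lpolyE -raddfMn /=.
  over.
rewrite -raddf_sum coef_act_bracket; congr << _ *g _ >>.
apply: (f_equal (fun q : P3 => q`_n`_m)).
rewrite ![ev _ _ (twist _ _ * _)]rmorphM !ev_twist.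
move: (Hp i j k); rewrite !addrA.
rewrite (_ : - (ll + mm) + ll = - mm); last by ring.
move=> H; apply: etrans (_ : _ = ev1 (- ll) f * ev1 (- mm) h *
  ev1 (dd + ll + mm) g * (ev (- (ll + mm)) ll (pB i j) *
  ev dd (ll + mm) (p (i + j) k))) _; first by ring.
rewrite H (addrAC dd mm ll); ring.
Qed.

Lemma skew_on_generators (brk : freeZ -> freeZ -> lpoly freeZ) :
  (forall a b v, brk (a + b) v = brk a v + brk b v) ->
  (forall a v w, brk a (v + w) = brk a v + brk a w) ->
  (forall f g i j n, (brk << f *g i >> << g *g j >>)@_n =
     - \sum_(k <- msupp (brk << g *g j >> << f *g i >>))
      (((-1) ^+ k * 'X^(k - n)) *+ 'C(k, n)) *:
         (brk << g *g j >> << f *g i >>)@_k) ->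
  lambda_skew brk.
Proof.
move=> brkDl brkDr gen a b n.
pose c k : {poly K} := ((-1) ^+ k * 'X^(k - n)) *+ 'C(k, n).
pose S (x : lpoly freeZ) := \sum_(k <- msupp x) c k *: x@_k.
have SD x y : S (x + y) = S x + S y.
  by apply: (@msumD _ _ _ (fun k z => c k *: z)) => k u v; rewrite scalerDr.
have S0 : S 0 = 0 by apply: (addrI (S 0)); rewrite -SD !addr0.
have brk0l v : brk 0 v = 0.
  by apply: (addrI (brk 0 v)); rewrite -brkDl !addr0.
have brk0r v : brk v 0 = 0.
  by apply: (addrI (brk v 0)); rewrite -brkDr !addr0.
rewrite -/(S (brk b a)).
elim/malg_ind: a => [|a1 a2 IH1 IH2|f i].
- by rewrite brk0l brk0r S0 mcoeff0 oppr0.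
- rewrite brkDl brkDr SD opprD -IH1 -IH2; exact: mcoeffD.
elim/malg_ind: b => [|b1 b2 IH1 IH2|g j]; last exact: gen.
- by rewrite brk0l brk0r S0 mcoeff0 oppr0.
- rewrite brkDl brkDr SD opprD -IH1 -IH2; exact: mcoeffD.
Qed.

Lemma coef_skew (q : {poly {poly K}}) n :
  (q \Po (- lamP - derP))`_n =
  \sum_(k < size q) ((-1) ^+ k * 'X^(k - n) *+ 'C(k, n)) * q`_k.
Proof.
rewrite comp_polyE coef_sum; apply: eq_bigr => k _.
rewrite coefZ mulrC; congr (_ * _).
rewrite -opprD [in LHS]exprNn addrC exprDn mulr_sumr coef_sum.
have E (l : 'I_k.+1) :
    ((-1) ^+ k * (derP ^+ (k - l) * lamP ^+ l *+ 'C(k, l)))`_n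
    = if (n == l)%N then (-1) ^+ k * 'X^(k - n) *+ 'C(k, n) else 0.
  rewrite /derP /lamP.
  have -> : (-1) ^+ k = ((-1) ^+ k : {poly K})%:P :> {poly {poly K}}.
    by rewrite rmorphXn rmorphN1.
  rewrite -rmorphXn coefCM coefMn coefCM coefXn.
  case: eqP => [->|_]; last by rewrite mulr0 mul0rn mulr0.
  by rewrite mulr1 mulrnAr.
rewrite (eq_bigr _ (fun l _ => E l)).
have [nk|nk] := leqP n k; last first.
  rewrite bin_small // mulr0n big1 // => l _.
  by case: eqP => // _; rewrite mulr0n.
rewrite (bigD1 (Ordinal (nk : n < k.+1)%N)) //= eqxx big1 ?addr0 // => l.
by rewrite -val_eqE /= eq_sym => /negPf ->.
Qed.

Lemma twist_skew f g : twist g f \Po (- lamP - derP) = twist f g.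
Proof.
rewrite /twist comp_polyM -!comp_polyA rmorphN /= rmorphD /=.
rewrite /lamP /derP comp_polyX comp_polyC mulrC.
by congr ((_ \Po _) * (_ \Po _)); ring.
Qed.

Lemma graded_product_skew (p : int -> int -> {poly {poly K}}) :
  (forall i j, p j i \Po (- lamP - derP) = - p i j) ->
  lambda_skew (graded_product p).
Proof.
move=> Hp; apply: skew_on_generators => [||f g i j n].
- exact: graded_productDl.
- exact: graded_productDr.
rewrite !graded_productU basis_lpolyE.
set q := twist g f * p j i.
pose h k (z : freeZ) := ((-1) ^+ k * 'X^(k - n) *+ 'C(k, n)) *: z.
pose s := iota 0 (size q).
rewrite (@msum_widen _ _ _ h _ _ s) ?iota_uniq //; last first.
- move=> k; rewrite -mcoeff_neq0 basis_lpolyE mem_iota /= add0n.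
  by rewrite ltnNge; apply: contra => sk; rewrite nth_default // raddf0.
- by move=> k x y; rewrite /h scalerDr.
rewrite /s -[size q]subn0 big_mkord /h.
under [in RHS]eq_bigr => k _.
  rewrite basis_lpolyE freeZ_scaleU (addrC j i).
  over.
rewrite -raddf_sum -raddfN; congr << _ *g _ >>.
rewrite -coef_skew /q comp_polyM twist_skew Hp mulrN coefN opprK.
by [].
Qed.

End GradedProducts.

Section Identities.
Variable S : comNzRingType.
Implicit Types (d l m C D : S) (i j k : int).

Definition V_D_value d l D i j : S :=
  if (j != 0) && (i + j != 0) then (i + j)%:~R * l + i%:~R * (d + D)
  else if j == 0 then i%:~R * (l + d + D) ^+ 2 else i%:~R.

Definition V'_D_value d l D i j : S :=
  if (j != 0) && (i + j != 0) then (i + j)%:~R * l + i%:~R * (d + D)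
  else if j == 0 then i%:~R else i%:~R * (d + D) ^+ 2.

Lemma V_CD_identity d l m C D i j k :
  (i%:~R * - (l + m) + (i + j)%:~R * l) *
    (((i + j + k)%:~R + C) * (l + m) + (i + j)%:~R * (d + D)) =
  (((i + (j + k))%:~R + C) * l + i%:~R * (d + D)) *
    (((j + k)%:~R + C) * m + j%:~R * (d + l + D)) -
  (((j + (i + k))%:~R + C) * m + j%:~R * (d + D)) *
    (((i + k)%:~R + C) * l + i%:~R * (d + m + D)).
Proof. by ring. Qed.

Ltac solve_cases i j k :=
  have [k0|k0] := eqVneq k 0; have [jk|jk] := eqVneq (j + k) 0;
  have [ik|ik] := eqVneq (i + k) 0; have [ijk|ijk] := eqVneq (i + j + k) 0;
  rewrite /=;
  try (exfalso; lia);
  try (have -> : k = 0 by lia);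
  try (have -> : j = 0 by lia);
  try (have -> : i = 0 by lia);
  try (have -> : j = - k by lia);
  try (have -> : i = - k by lia);
  try (have -> : i = - j by lia);
  try (have -> : i = - (j + k) by lia); ring.

Lemma V_D_identity d l m D i j k :
  (i%:~R * - (l + m) + (i + j)%:~R * l) * V_D_value d (l + m) D (i + j) k =
  V_D_value d l D i (j + k) * V_D_value (d + l) m D j k -
  V_D_value d m D j (i + k) * V_D_value (d + m) l D i k.
Proof.
rewrite /V_D_value (addrCA j i k) (addrA i j k).
solve_cases i j k.
Qed.

Lemma V'_D_identity d l m D i j k :
  (i%:~R * - (l + m) + (i + j)%:~R * l) * V'_D_value d (l + m) D (i + j) k =
  V'_D_value d l D i (j + k) * V'_D_value (d + l) m D j k -
  V'_D_value d m D j (i + k) * V'_D_value (d + m) l D i k.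
Proof.
rewrite /V'_D_value (addrCA j i k) (addrA i j k).
solve_cases i j k.
Qed.

End Identities.

Section Modules.
Variable K : fieldType.
Local Notation lam := (lamP K).
Local Notation der := (derP K).

Definition intP (n : int) : {poly {poly K}} := cstP n%:~R.

(* [L_i _lambda L_j] = (i d + (i + j) lambda) L_(i + j) *)
Definition B_coef (i j : int) : {poly {poly K}} :=
  intP i * der + intP (i + j) * lam.

Definition V_CD_coef (C D : K) (i j : int) : {poly {poly K}} :=
  cstP ((i + j)%:~R + C) * lam + intP i * (der + cstP D).

Definition V_D_coef (D : K) (i j : int) : {poly {poly K}} :=
  if (j != 0) && (i + j != 0) then
    intP (i + j) * lam + intP i * (der + cstP D)
  else if j == 0 then intP i * (lam + der + cstP D) ^+ 2
  else intP i.

Definition V'_D_coef (D : K) (i j : int) : {poly {poly K}} :=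
  if (j != 0) && (i + j != 0) then
    intP (i + j) * lam + intP i * (der + cstP D)
  else if j == 0 then intP i
  else intP i * (der + cstP D) ^+ 2.

Lemma ev_int d l n : ev d l (intP n) = n%:~R.
Proof. by rewrite /intP evC rmorph_int. Qed.

Lemma B_skew : lambda_skew (graded_product B_coef).
Proof.
apply: graded_product_skew => i j; rewrite /B_coef /intP /cstP /derP /lamP.
rewrite comp_polyD !comp_polyM !comp_polyC comp_polyX.
by rewrite (addrC j i) !rmorphD /=; ring.
Qed.

Lemma ev_B d l i j :
  ev d l (B_coef i j) = i%:~R * d + (i + j)%:~R * l.
Proof. by rewrite rmorphD !rmorphM !ev_int evd evl. Qed.

Lemma ev_V_CD C D d l i j : ev d l (V_CD_coef C D i j) =
  ((i + j)%:~R + cst3 K C) * l + i%:~R * (d + cst3 K D).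
Proof.
rewrite rmorphD !rmorphM ev_int [ev _ _ (_ + cstP D)]rmorphD !evC evd evl.
by rewrite [cst3 K (_ + C)]rmorphD rmorph_int.
Qed.

Lemma ev_V_D D d l i j :
  ev d l (V_D_coef D i j) = V_D_value d l (cst3 K D) i j.
Proof.
rewrite /V_D_coef /V_D_value; case: ifP => _; last case: ifP => _.
- rewrite rmorphD !rmorphM !ev_int.
  by rewrite [ev _ _ (_ + cstP D)]rmorphD evC evd evl.
- by rewrite rmorphM ev_int rmorphXn !rmorphD evC evd evl.
- exact: ev_int.
Qed.

Lemma ev_V'_D D d l i j :
  ev d l (V'_D_coef D i j) = V'_D_value d l (cst3 K D) i j.
Proof.
rewrite /V'_D_coef /V'_D_value; case: ifP => _; last case: ifP => _.
- rewrite rmorphD !rmorphM !ev_int.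
  by rewrite [ev _ _ (_ + cstP D)]rmorphD evC evd evl.
- exact: ev_int.
- by rewrite rmorphM ev_int rmorphXn !rmorphD evC evd.
Qed.

Lemma B_jacobi :
  lambda_jacobi (graded_product B_coef) (graded_product B_coef).
Proof.
by apply: graded_product_jacobi => i j k; rewrite !ev_B; ring.
Qed.

Lemma V_CD_jacobi C D :
  lambda_jacobi (graded_product B_coef) (graded_product (V_CD_coef C D)).
Proof.
apply: graded_product_jacobi => i j k; rewrite !ev_B !ev_V_CD.
exact: V_CD_identity.
Qed.

Lemma V_D_jacobi D :
  lambda_jacobi (graded_product B_coef) (graded_product (V_D_coef D)).
Proof.
apply: graded_product_jacobi => i j k; rewrite !ev_B !ev_V_D.
exact: V_D_identity.
Qed.

Lemma V'_D_jacobi D :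
  lambda_jacobi (graded_product B_coef) (graded_product (V'_D_coef D)).
Proof.
apply: graded_product_jacobi => i j k; rewrite !ev_B !ev_V'_D.
exact: V'_D_identity.
Qed.

Definition B : lieConformalAlgebra K :=
  LieConformalAlgebra (graded_product_is_lambda_product B_coef)
    B_skew B_jacobi.

Definition V_CD (C D : K) : conformalModule B :=
  @ConformalModule K B _ _
    (graded_product_is_lambda_product (V_CD_coef C D)) (V_CD_jacobi C D).

Definition V_D (D : K) : conformalModule B :=
  @ConformalModule K B _ _
    (graded_product_is_lambda_product (V_D_coef D)) (V_D_jacobi D).

Definition V'_D (D : K) : conformalModule B :=
  @ConformalModule K B _ _
    (graded_product_is_lambda_product (V'_D_coef D)) (V'_D_jacobi D).

(* V is Z-graded as a B-module (B_i = K[d] L_i), each component being freely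
   generated over K[d] by one element. *)
Definition free_intermediate_series (V : conformalModule B) : Prop :=
  exists G : int -> V -> Prop,
    [/\ is_grading G,
        forall (i j : int) (f : {poly K}) (v : V) (n : nat),
          G j v -> G (i + j) (lact (f *: << i >> : B) v)@_n
      & forall j : int, exists vj : V,
          [/\ G j vj, forall w, G j w -> exists f : {poly K}, w = f *: vj
            & forall f : {poly K}, f *: vj = 0 -> f = 0]].

End Modules.

(* Main.v *)
From HB Require Import structures.
Require Import Defs.
From mathcomp Require Import all_boot all_order all_algebra.
From mathcomp Require Import complex reals boolp finmap monalg zify ring.

Set Implicit Arguments.
Unset Strict Implicit.
Unset Printing Implicit Defensive.

Import GRing.Theory.
Local Open Scope ring_scope.

(* In a homogeneous basis (v_k) the action is L_i _lambda v_k = p_(i,k) v_(i+k),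
   and the module axiom becomes a quadratic functional equation for the
   polynomials p_(i,k)(lambda, d).  Taking i = 0 in it forces
   p_(0,k) = (k + C) lambda for one constant C, and then shows that p_(i,k) is
   affine, p_(i,k) = X_(i,k) (i d + (i + k + C) lambda + y_(i,k)), unless
   k + C = 0 or i + k + C = 0.  The X_(i,k) form a multiplicative cocycle, hence
   become 1 after rescaling the v_k, and y_(i,k) = i D.  If C is not an integer
   this is V_(C,D).  Otherwise shift the grading so that C = 0; the arrows out
   of and into v_0 are i g(lambda + d + D) and i h(d + D) with g(s) h(s) = s^2,
   and the three factorizations of s^2 give V'_D, V_(0,D) and V_D. *)

(** * Univariate polynomials in characteristic 0 *)

Section CharacteristicZero.
Variable K : fieldType.
Hypothesis K0 : [pchar K] =i pred0.
Implicit Types (f g q : {poly K}) (u : {poly {poly K}}).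

Lemma natr_eq0_pchar0 (n : nat) : (n%:R == 0 :> K) = (n == 0)%N.
Proof. by move/pcharf0P: K0; apply. Qed.

Lemma intr_eq0_pchar0 (n : int) : (n%:~R == 0 :> K) = (n == 0).
Proof.
case: n => n; first exact: natr_eq0_pchar0.
by rewrite NegzE rmorphN /= !oppr_eq0; apply: natr_eq0_pchar0.
Qed.

(** In characteristic 0 the naturals below [size f] are distinct in [K], too many to be all
    roots. *)
Lemma poly_neq0_nat f : f != 0 -> exists n : nat, f.[n%:R] != 0.
Proof.
move=> nz; pose s : seq K := [seq n%:R | n <- iota 0 (size f)].
have us : uniq s.
  rewrite map_inj_uniq ?iota_uniq // => m n /eqP.
  wlog le_mn : m n / (m <= n)%N => [hw|].
    case: (leqP m n) => [|/ltnW] le; first exact: hw.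
    by rewrite eq_sym => /(hw _ _ le).
  rewrite -subr_eq0 -opprB oppr_eq0 -natrB // natr_eq0_pchar0 subn_eq0 => nm.
  by apply/eqP; rewrite eqn_leq le_mn.
have [rs|/allPn [x /mapP [n _ ->] fn]] := boolP (all (root f) s);
  last by exists n.
by have := max_poly_roots nz rs us; rewrite size_map size_iota ltnn.
Qed.

Lemma poly_eq0_nat f : (forall n : nat, f.[n%:R] = 0) -> f = 0.
Proof.
move=> f0; apply/eqP/negPn/negP => /poly_neq0_nat [n].
by rewrite f0 eqxx.
Qed.

Lemma poly_ext_pchar0 f g : (forall x, f.[x] = g.[x]) -> f = g.
Proof.
move=> fg; apply/eqP; rewrite -subr_eq0; apply/eqP/poly_eq0_nat => n.
by rewrite !hornerE fg subrr.
Qed.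

Lemma poly_ext_neq0 f g : (forall x, x != 0 -> f.[x] = g.[x]) -> f = g.
Proof.
move=> fg; suff: 'X * f = 'X * g by apply: mulfI; rewrite polyX_eq0.
apply: poly_ext_pchar0 => x; rewrite !hornerE.
by have [->|/fg ->] := eqVneq x 0; rewrite ?mul0r.
Qed.

Lemma poly_neq0_val f : f != 0 -> exists2 x, x != 0 & f.[x] != 0.
Proof.
move=> nz; have : 'X * f != 0 by rewrite mulf_neq0 ?polyX_eq0.
case/poly_neq0_nat => n; rewrite hornerM hornerX mulf_eq0 negb_or.
by case/andP; exists n%:R.
Qed.

Lemma horner_additive f : (forall x y, f.[x + y] = f.[x] + f.[y]) ->
  forall x, f.[x] = f.[1] * x.
Proof.
move=> fD x; suff -> : f = f.[1] *: 'X by rewrite !hornerE.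
apply/eqP; rewrite -subr_eq0; apply/eqP/poly_eq0_nat; elim=> [|n IH].
  rewrite hornerD hornerN hornerZ hornerX mulr0 subr0.
  by apply: (addrI f.[0]); rewrite -fD !addr0.
move: IH; rewrite -natr1 !(hornerD, hornerN, hornerZ, hornerX) fD => IH.
by rewrite -[RHS]IH; ring.
Qed.

(** A vanishing second difference makes [f - f(0)] additive, hence linear. *)
Lemma horner_affine f :
  (forall x y z, f.[z + x + y] - f.[z + x] - f.[z + y] + f.[z] = 0) ->
  exists x y, forall d, f.[d] = x * d + y.
Proof.
move=> fD; pose g := f - f.[0]%:P.
have gD x y : g.[x + y] = g.[x] + g.[y].
  have := fD x y 0; rewrite !add0r !(hornerD, hornerN, hornerC) => H.
  by apply/eqP; rewrite -subr_eq0 -[X in _ == X]H; apply/eqP; ring.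
exists g.[1], f.[0] => d; rewrite -(horner_additive gD) !(hornerD, hornerN,
  hornerC); ring.
Qed.

(** [f(l X) - f(0)] vanishes at every natural number, hence is zero, and [l] is invertible. *)
Lemma horner_periodic f l : l != 0 -> (forall x, f.[x + l] = f.[x]) ->
  forall x, f.[x] = f.[0].
Proof.
move=> l0 fl.
have fn (n : nat) : f.[n%:R * l] = f.[0].
  elim: n => [|n IH]; first by rewrite mul0r.
  by rewrite -natr1 mulrDl mul1r fl.
have E : (f \Po (l *: 'X)) = f.[0]%:P.
  apply/eqP; rewrite -subr_eq0; apply/eqP/poly_eq0_nat => n.
  by rewrite !hornerE horner_comp !hornerE mulrC fn subrr.
move=> x; have := congr1 (horner^~ (l^-1 * x)) E.
by rewrite /= horner_comp hornerZ hornerX hornerC mulrA divff // mul1r.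
Qed.

Lemma size_comp_XaddC f c : size (f \Po ('X + c%:P)) = size f.
Proof. by rewrite size_comp_poly2 // size_XaddC. Qed.

Lemma coef_comp_XaddC_lead f c n : (size f <= n.+1)%N ->
  (f \Po ('X + c%:P))`_n = f`_n.
Proof.
elim/poly_ind: f n => [|f b IH] n; first by rewrite comp_poly0 !coef0.
rewrite comp_poly_MXaddC size_MXaddC => sf.
have {}sf : (size f <= n)%N.
  by case: ifP sf => // /andP [/eqP -> _]; rewrite size_poly0.
rewrite mulrDr [_ * c%:P]mulrC !coefD !coefMX coefCM.
rewrite (nth_default _ (_ : size (f \Po _) <= n)%N) ?size_comp_XaddC //.
rewrite mulr0 addr0; case: n sf => [|n] //= sf; by rewrite IH.
Qed.

Lemma coef_comp_XaddC_sublead f c n : (size f <= n.+2)%N ->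
  (f \Po ('X + c%:P))`_n = f`_n + f`_n.+1 * c *+ n.+1.
Proof.
elim/poly_ind: f n => [|f b IH] n.
  by rewrite comp_poly0 !coef0 mul0r mul0rn addr0.
rewrite comp_poly_MXaddC size_MXaddC => sf.
have {}sf : (size f <= n.+1)%N.
  by case: ifP sf => // /andP [/eqP -> _]; rewrite size_poly0.
rewrite mulrDr [_ * c%:P]mulrC !coefD !coefMX !coefC coefCM.
rewrite addr0 (@coef_comp_XaddC_lead f c n) //.
case: n sf => [|n] /= sf; first by rewrite mulr1n; ring.
by rewrite IH // [in RHS]mulrS; ring.
Qed.

(** Swapping the variables exhibits each coefficient in d as a polynomial in lambda, here evaluated
    at [l]. *)
Lemma coef_hornerC u l i : u.[l%:P]`_i = ((swapXY u)`_i).[l].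
Proof. by rewrite -{1}[u]swapXYK horner_swapXY coef_map. Qed.

End CharacteristicZero.

(** * The action of L_0 *)

(** Reduces a goal to a [ring] identity: [a = b] is a combination of known equations with the same
    difference of sides as the goal. *)
Lemma eq_of_sub_eq (M : zmodType) (a b x y : M) :
  a = b -> x - y = a - b -> x = y.
Proof. by move=> -> /eqP; rewrite subrr subr_eq0 => /eqP. Qed.

(* The module axiom for L_i, L_j acting on v_k, at lambda = l, mu = m, d = d. *)
Definition jacobi_coef (K : fieldType) (p : int -> int -> {poly {poly K}}) :=
  forall (i j k : int) (l m d : K),
    (j%:~R * l - i%:~R * m) * (p (i + j) k).[(l + m)%:P].[d] =
    (p i (j + k)).[l%:P].[d] * (p j k).[m%:P].[d + l] -
    (p j (i + k)).[m%:P].[d] * (p i k).[l%:P].[d + m].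

Section Weights.
Variable K : fieldType.
Hypothesis K0 : [pchar K] =i pred0.
Variable p : int -> int -> {poly {poly K}}.
Hypothesis pJ : jacobi_coef p.
Local Notation F i j l d := (p i j).[l%:P].[d].

(* [p 0 k] does not involve d (see [weightE]); this is [p 0 k] as a polynomial
   in lambda. *)
Definition weight (k : int) : {poly K} := (swapXY (p 0 k))`_0.

(* With A_l = p_(0,k)(l, -), the axiom for i = j = 0 and m = - l says that
   A_l(d) A_(-l)(d + l) is l-periodic in d, hence constant. *)
Lemma weightE k l : (p 0 k).[l%:P] = (weight k).[l]%:P.
Proof.
pose A l := (p 0 k).[l%:P]; pose U := swapXY (p 0 k).
have cst i x : (0 < i)%N -> x * (U`_i).[x] * (U`_i).[- x] = 0.
  move=> i0; have [->|x0] := eqVneq x 0; first by rewrite !mul0r.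
  rewrite /U -!coef_hornerC -/(A x) -/(A (- x)).
  have [->|Ax] := eqVneq (A x) 0; first by rewrite coef0 mulr0 mul0r.
  have [->|Ay] := eqVneq (A (- x)) 0; first by rewrite coef0 mulr0.
  pose f := A x * (A (- x) \Po ('X + x%:P)).
  have fE d : f.[d] = (A x).[d] * (A (- x)).[d + x].
    by rewrite hornerM horner_comp !hornerE.
  have fx d : f.[d + x] = f.[d].
    have := pJ 0 0 k x (- x) (d + x).
    rewrite !fE !add0r mul0r mul0r subrr mul0r addrK -/(A x) -/(A (- x)).
    by move=> /eqP; rewrite eq_sym subr_eq0 => /eqP ->; rewrite mulrC.
  have fC : f = f.[0]%:P.
    by apply: (poly_ext_pchar0 K0) => d; rewrite hornerC (horner_periodic K0 x0
      fx).
  (* Degrees add in the product [f], which is constant, so [A x] is constant in d. *)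
  have : (size f <= 1)%N by rewrite fC size_polyC leq_b1.
  have Ac : A (- x) \Po ('X + x%:P) != 0.
    by rewrite comp_poly2_eq0 ?size_XaddC.
  rewrite size_mul // size_comp_XaddC => sf.
  have sA : (size (A x) <= 1)%N.
    move: sf; rewrite -(size_poly_gt0 (A (- x))) in Ay; move: Ay.
    by case: (size (A (- x))) => // n _; rewrite addnS /=; apply:
      leq_trans (leq_addr _ _).
  by rewrite (nth_default _ (leq_trans sA i0)) mulr0 mul0r.
have U0 i : (0 < i)%N -> U`_i = 0.
  move=> i0; have /eqP : 'X * U`_i * (U`_i \Po (- 'X)) = 0.
    apply: (poly_ext_pchar0 K0) => x; rewrite !(hornerM, hornerX, horner0,
      horner_comp, hornerN).
    exact: cst.
  rewrite !mulf_eq0 polyX_eq0 comp_poly2_eq0 ?size_polyN ?size_polyX //= orbb.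
  by move/eqP.
apply/polyP => -[|i]; rewrite coef_hornerC coefC //=.
by rewrite -/U U0 // horner0.
Qed.

Lemma jacobi_weight j k l m d :
  j%:~R * l * F j k (l + m) d =
  (weight (j + k)).[l] * F j k m (d + l) - F j k m d * (weight k).[l].
Proof.
have := pJ 0 j k l m d.
by rewrite !add0r mul0r subr0 !weightE !hornerC.
Qed.

(* Compare the two highest coefficients in d of [jacobi_weight]. *)
Lemma weight_step j k : p j k != 0 -> j != 0 ->
  (forall l, (weight (j + k)).[l] = (weight k).[l] + j%:~R * l) /\
  ((exists c, forall l d, F j k l d = c) \/
   (forall l, (1 < size (p j k).[l%:P])%N) /\
   exists A, weight k = A *: 'X).
Proof.
move=> p0 j0; have jK : j%:~R != 0 :> K by rewrite intr_eq0_pchar0.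
pose P m := (p j k).[m%:P]; pose U := swapXY (p j k).
have Unz : U != 0 by rewrite swapXY_eq0.
(* [n] is the degree of [p j k] in d, and [c] its leading coefficient, a polynomial in lambda. *)
pose n := (size U).-1; pose c := U`_n.
have cnz : c != 0 by rewrite -[c]/(lead_coef U) lead_coef_eq0.
have PE m i : (P m)`_i = (U`_i).[m] by apply: coef_hornerC.
have sP m : (size (P m) <= n.+1)%N.
  apply/leq_sizeP => i ni; rewrite PE nth_default ?horner0 //.
  by apply: leq_trans ni; rewrite /n leqSpred.
have PJ l m : (j%:~R * l) *: P (l + m) =
    (weight (j + k)).[l] *: (P m \Po ('X + l%:P)) - (weight k).[l] *: P m.
  apply: (poly_ext_pchar0 K0) => d; have := jacobi_weight j k l m d.
  rewrite hornerD hornerN !hornerZ horner_comp hornerD hornerX hornerC => ->.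
  by congr (_ - _); rewrite mulrC.
pose b l := (weight (j + k)).[l] - (weight k).[l].
have cJ l m : j%:~R * l * c.[l + m] = b l * c.[m].
  have := congr1 (fun f : {poly K} => f`_n) (PJ l m).
  rewrite /= coefB !coefZ coef_comp_XaddC_lead // !PE => ->.
  by rewrite /b mulrBl.
(* Comparing leading coefficients in [m] on the two sides of [cJ] gives [b]. *)
have bE l : b l = j%:~R * l.
  have : (j%:~R * l) *: (c \Po ('X + l%:P)) = b l *: c.
    apply: (poly_ext_pchar0 K0) => m.
    by rewrite !hornerZ horner_comp hornerD hornerX hornerC -cJ [m + l]addrC.
  move/(congr1 (fun f : {poly K} => f`_(size c).-1)).
  rewrite /= !coefZ coef_comp_XaddC_lead ?leqSpred //.
  by move/mulIf => -> //; rewrite -/(lead_coef c) lead_coef_eq0.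
have wE l : (weight (j + k)).[l] = (weight k).[l] + j%:~R * l.
  by rewrite -bE /b [RHS]addrC subrK.
split=> //.
have cC x : c.[x] = c.[0].
  apply: (horner_periodic K0 (oner_neq0 K)) => y.
  have := cJ 1 y; rewrite bE [1 + y]addrC.
  by apply: mulfI; rewrite mulr1.
have c0 : c.[0] != 0.
  apply: contra cnz => /eqP c0; apply/eqP/(poly_ext_pchar0 K0) => x.
  by rewrite cC c0 horner0.
(* If [n = 0], then [p j k] is the constant [c]. Otherwise the constant leading coefficient keeps d
   present at every value of lambda. *)
case En : n => [|n'].
  left; exists c.[0] => l d.
  have := sP l; rewrite En -/(P l) => /size1_polyC ->.
  by rewrite hornerC PE; move: (cC l); rewrite /c En.
right; split=> [l|].
  rewrite ltnNge; apply/negP => sl.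
  have := PE l n; rewrite -/c cC nth_default ?En; first by move/esym/eqP;
    rewrite (negPf c0).
  exact: leq_trans sl _.
(* The coefficient of d^(n-1) in [PJ] isolates an expression in [l] alone, so [c' - c'(0)] is
   additive, hence linear, and the weight is a multiple of ['X]. *)
pose c' := U`_n'; pose N : K := n'.+1%:R.
have N0 : N != 0 by rewrite natr_eq0_pchar0.
have c'J l m : l != 0 ->
    j%:~R * (c'.[l + m] - c'.[m] - c.[0] * l * N) * l =
      (weight k).[l] * (c.[0] * l * N).
  move=> l0; have := congr1 (fun f : {poly K} => f`_n') (PJ l m).
  rewrite /= coefB !coefZ coef_comp_XaddC_sublead -?En // !PE -/c cC wE.
  rewrite -/c' En -[_ *+ _.+1]mulr_natr -/N => H.
  by apply: (eq_of_sub_eq H); ring.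
have c'0 l : l != 0 ->
    j%:~R * (c'.[l] - c'.[0] - c.[0] * l * N) * l =
      (weight k).[l] * (c.[0] * l * N).
  by move=> l0; rewrite -(c'J l 0) // addr0.
clearbody N; pose f := c' - c'.[0]%:P.
have fE x : f.[x] = c'.[x] - c'.[0] by rewrite hornerD hornerN hornerC.
have fD x y : f.[x + y] = f.[x] + f.[y].
  rewrite !fE; have [->|x0] := eqVneq x 0; first by rewrite add0r subrr add0r.
  have : j%:~R * (c'.[x + y] - c'.[y] - c.[0] * x * N) * x =
         j%:~R * (c'.[x] - c'.[0] - c.[0] * x * N) * x by rewrite c'J // c'0.
  move/(mulIf x0)/(mulfI jK) => H; apply: (eq_of_sub_eq H); ring.
exists (j%:~R * (f.[1] - c.[0] * N) / (c.[0] * N)).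
apply: (poly_ext_neq0 K0) => l l0; rewrite hornerZ hornerX.
have cN : c.[0] * N != 0 by rewrite mulf_neq0.
apply: (mulIf cN); apply: (mulIf l0); rewrite -[LHS]mulrA.
transitivity ((weight k).[l] * (c.[0] * l * N)); first by ring.
rewrite -c'0 // -fE (horner_additive K0 fD); field.
by rewrite N0 c0.
Qed.

Lemma const_or_weight j k : j != 0 ->
  (exists c, forall l d, F j k l d = c) \/ exists A, weight k = A *: 'X.
Proof.
move=> j0; have [->|p0] := eqVneq (p j k) 0.
  by left; exists 0 => l d; rewrite !horner0.
by case: (weight_step p0 j0) => _ [|[_]]; [left|right].
Qed.

(* If there is no arrow between k and i + k in either direction, the axiom for
   i, - i at k leaves a single product, which does not involve d; so both its
   factors are constant, whereas the left-hand side is not. *)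
Lemma weight_connected k i : weight k != 0 ->
  forall l, (weight (i + k)).[l] = (weight k).[l] + i%:~R * l.
Proof.
move=> wk l; have [->|i0] := eqVneq i 0; first by rewrite add0r mul0r addr0.
have iK : i%:~R != 0 :> K by rewrite intr_eq0_pchar0.
have [pik|pik] := eqVneq (p i k) 0; last by case: (weight_step pik i0).
have ni0 : - i != 0 by rewrite oppr_eq0.
have [pki|pki] := eqVneq (p (- i) (i + k)) 0; last first.
  case: (weight_step pki ni0) => /(_ l) + _.
  by rewrite addKr => ->; rewrite rmorphN /= mulNr subrK.
exfalso; have [x x0 wx] := poly_neq0_val K0 wk.
have J y m d : F i (- i + k) y d * F (- i) k m (d + y) =
    - (i%:~R * (y + m)) * (weight k).[y + m].
  have := pJ i (- i) k y m d.
  rewrite pki !horner0 mul0r subr0 subrr weightE hornerC rmorphN /= => <-; ring.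
pose P := (p i (- i + k)).[x%:P]; pose Q := (p (- i) k).[0%:P].
have PQ : P * (Q \Po ('X + x%:P)) = (- (i%:~R * x) * (weight k).[x])%:P.
  apply: (poly_ext_pchar0 K0) => d.
  by rewrite hornerM horner_comp hornerD hornerX !hornerC J addr0.
have PQ0 : P * (Q \Po ('X + x%:P)) != 0.
  by rewrite PQ polyC_eq0 !mulf_neq0 // oppr_eq0 mulf_neq0.
move: (PQ0); rewrite mulf_eq0 negb_or => /andP [P0 Q0].
have {}Q0 : Q != 0 by rewrite comp_poly2_eq0 ?size_XaddC in Q0.
have pP : p i (- i + k) != 0 by apply: contraNneq P0; rewrite /P => ->;
  rewrite horner0.
have pQ : p (- i) k != 0 by apply: contraNneq Q0; rewrite /Q => ->;
  rewrite horner0.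
have s2 : (size P <= 1)%N && (size Q <= 1)%N.
  have : (size (P * (Q \Po ('X + x%:P)))%R <= 1)%N by rewrite PQ size_polyC
    leq_b1.
  rewrite size_mul ?comp_poly2_eq0 ?size_XaddC // size_comp_XaddC.
  rewrite -size_poly_gt0 in P0; rewrite -size_poly_gt0 in Q0.
  move: (size P) (size Q) P0 Q0 => sP sQ; clear; lia.
case/andP: s2 => sP sQ.
case: (weight_step pP i0) => _ [[c cE]|[/(_ x)]]; last by rewrite ltnNge sP.
case: (weight_step pQ ni0) => _ [[c' c'E]|[/(_ 0)]]; last by rewrite ltnNge sQ.
(* The product is the constant [c * c'], yet it vanishes at [y = m = 0] and not at [y = x],
   [m = 0]. *)
have := J 0 0 0; have := J x 0 0; rewrite !cE !c'E !addr0 mulr0 oppr0 mul0r => ->.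
by apply/eqP; rewrite !mulf_neq0 // oppr_eq0 mulf_neq0.
Qed.

(** By [weight_connected], weights differ by linear terms once one of them is nonzero; it remains to
    find one nonzero weight and one linear weight. *)
Lemma weight_linear : (exists i j, p i j != 0) ->
  exists C, forall k l, (weight k).[l] = (k%:~R + C) * l.
Proof.
move=> [i [j pij]].
have [k wk] : exists k, weight k != 0.
  have [i0|i0] := eqVneq i 0.
    exists j; apply: contra pij => /eqP wj; rewrite i0.
    have : swapXY (p 0 j) = 0.
      apply/polyP => n; rewrite coef0; apply: (poly_ext_pchar0 K0) => x.
      by rewrite -coef_hornerC weightE wj !horner0 polyC0 coef0.
    by move/eqP; rewrite swapXY_eq0.
  case: (weight_step pij i0) => /(_ 1) + _.
  have [->|] := eqVneq (weight j) 0; last by exists j.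
  rewrite horner0 add0r mulr1 => wij; exists (i + j); apply: contraTneq isT => w0.
  by move: wij; rewrite w0 horner0 => /esym /eqP;
    rewrite intr_eq0_pchar0 ?(negPf i0).
(* If the four arrows joining [k] to its neighbours are all constant, the right-hand side of the
   axiom for 1, -1 at [k] agrees at [l = 0] and [l = x], while the left-hand side vanishes only at
   the former. *)
have [e [A wA]] : exists e A, weight (e + k) = A *: 'X.
  have [c1|[A wA]] := @const_or_weight 1 (- 1 + k) isT; last by exists (- 1), A.
  have [c2|[A wA]] := @const_or_weight (- 1) k isT; last by exists 0, A;
    rewrite add0r.
  have [c3|[A wA]] := @const_or_weight (- 1) (1 + k) isT; last by exists 1, A.
  have [c4|[A wA]] := @const_or_weight 1 k isT; last by exists 0, A;
    rewrite add0r.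
  case: c1 c2 c3 c4 => [c1 E1] [c2 E2] [c3 E3] [c4 E4].
  have [x x0 wx] := poly_neq0_val K0 wk.
  have := pJ 1 (- 1) k x 0 0; have := pJ 1 (- 1) k 0 0 0.
  rewrite !E1 !E2 !E3 !E4 => <-; rewrite !addr0 !mulr0 !subr0 mul0r.
  rewrite weightE hornerC rmorphN1 mulN1r => /eqP.
  by rewrite mulf_eq0 oppr_eq0 (negPf x0) (negPf wx).
have eK y : (weight k).[y] = (A - e%:~R) * y.
  have := weight_connected e wk y; rewrite wA hornerZ hornerX => H.
  by apply: (eq_of_sub_eq (esym H)); ring.
exists (A - e%:~R - k%:~R) => j' l.
have := weight_connected (j' - k) wk l; rewrite subrK eK => ->.
by rewrite rmorphB /=; ring.
Qed.

End Weights.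

(** * Arrows between vertices of nonzero weight *)

(* [apply: (eq_of_sub_eq e)], for a combination [e] of known equations built with
   these notations, leaves an identity for [ring]. *)
Local Notation "c *E H" := (congr1 ( *%R c) H) (at level 40).
Local Notation "H1 +E H2" := (f_equal2 +%R H1 H2) (at level 50, left
  associativity).

Section Edges.
Variable K : fieldType.
Hypothesis K0 : [pchar K] =i pred0.
Variable p : int -> int -> {poly {poly K}}.
Hypothesis pJ : jacobi_coef p.
Variable C : K.
Local Notation F i j l d := (p i j).[l%:P].[d].
Hypothesis p0E : forall k l d, F 0 k l d = (k%:~R + C) * l.

Lemma jacobi_shift j k l m d :
  j%:~R * F j k (l + m) d * l =
  (((j + k)%:~R + C) * F j k m (d + l) - (k%:~R + C) * F j k m d) * l.
Proof.
have := pJ 0 j k l m d; rewrite !add0r !p0E mul0r subr0 => H.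
by apply: (eq_of_sub_eq H); ring.
Qed.

(** The axiom for [L_0] at [m = 0], divided by [l]: for nonzero [j], the restriction to lambda = 0
    determines [p j k]. *)
Lemma coef_from_lambda0 j k l d :
  j%:~R * F j k l d =
  ((j + k)%:~R + C) * F j k 0 (d + l) - (k%:~R + C) * F j k 0 d.
Proof.
have [->|l0] := eqVneq l 0; first by rewrite addr0; ring.
by apply: (mulIf l0); rewrite -jacobi_shift addr0.
Qed.

Lemma coef_affine j k : k%:~R + C != 0 -> (j + k)%:~R + C != 0 ->
  exists x y, forall d, F j k 0 d = x * d + y.
Proof.
move=> k0 jk0; apply: (horner_affine K0) => l m d.
have [->|l0] := eqVneq l 0; first by rewrite addr0; ring.
apply/eqP; have /mulfI : (k%:~R + C) * ((j + k)%:~R + C) != 0 by rewrite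
  mulf_neq0.
move=> inj; apply/eqP/inj; apply: (mulIf l0).
have H := jacobi_shift j k l m d.
have E1 := coef_from_lambda0 j k m (d + l).
have E2 := coef_from_lambda0 j k m d.
have E3 := coef_from_lambda0 j k (l + m) d.
rewrite addrA in E3.
(* Eliminating the values at [m] and [l + m] from [H] leaves [l] times the second difference of
   [F j k 0], times both weights. *)
apply: (eq_of_sub_eq (- j%:~R *E H +E j%:~R * l *E E3
  +E - (((j + k)%:~R + C) * l) *E E1 +E (k%:~R + C) * l *E E2)).
ring.
Qed.

(** The factor [X_(j,k)], read off the coefficient of d at lambda = 0. For [j = 0] that coefficient
    carries no information, and 1 fits [p_(0,k) = (k + C) lambda]. *)
Definition slope (j k : int) : K :=
  if j == 0 then 1 else (F j k 0 1 - F j k 0 0) / j%:~R.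

Lemma edgeE j k l d : k%:~R + C != 0 -> (j + k)%:~R + C != 0 ->
  F j k l d = slope j k * (j%:~R * d + ((j + k)%:~R + C) * l) + F j k 0 0.
Proof.
move=> k0 jk0; rewrite /slope; have [->|j0] := eqVneq j 0.
  by rewrite !p0E add0r; ring.
have jK : j%:~R != 0 :> K by rewrite intr_eq0_pchar0.
have [x [y xy]] := coef_affine k0 jk0.
apply: (mulfI jK); rewrite coef_from_lambda0 !xy rmorphD /=; field.
exact: jK.
Qed.

(* At most one vertex has weight 0, and it may be placed at 0: [full] means that
   there is none, so that [ok] holds at vertices of nonzero weight. *)
Variable full : bool.
Definition ok (k : int) := full || (k != 0).
Hypothesis okC : forall k, ok k -> k%:~R + C != 0.

(* The part of the axiom at d = m = 0 that is even in l. *)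
Lemma slopeM i j k : ok k -> ok (i + k) -> ok (j + k) -> ok (i + j + k) ->
  slope (i + j) k = slope i (j + k) * slope j k.
Proof.
move=> k0 ik jk ijk.
have [->|j0] := eqVneq j 0; first by rewrite addr0 {3}/slope eqxx mulr1 add0r.
have jK : j%:~R != 0 :> K by rewrite intr_eq0_pchar0.
have J l m d : (j%:~R * l - i%:~R * m) *
  (slope (i + j) k * ((i + j)%:~R * d + ((i + j + k)%:~R + C) * (l + m)) + F (i
    + j) k 0 0) =
  (slope i (j + k) * (i%:~R * d + ((i + (j + k))%:~R + C) * l) + F i (j + k) 0
    0) *
  (slope j k * (j%:~R * (d + l) + ((j + k)%:~R + C) * m) + F j k 0 0) -
  (slope j (i + k) * (j%:~R * d + ((j + (i + k))%:~R + C) * m) + F j (i + k) 0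
    0) *
  (slope i k * (i%:~R * (d + m) + ((i + k)%:~R + C) * l) + F i k 0 0).
  have ijk' : ok (i + (j + k)) by rewrite addrA.
  have jik' : ok (j + (i + k)) by rewrite addrCA.
  rewrite -!edgeE ?okC //; exact: pJ.
have two : 2%:R != 0 :> K by rewrite natr_eq0_pchar0.
move: J; set s1 := slope (i + j) k; set s2 := slope i (j + k).
set s3 := slope j k; set s4 := slope j (i + k); set s5 := slope i k.
set y1 := F (i + j) k 0 0; set y2 := F i (j + k) 0 0; set y3 := F j k 0 0.
set y4 := F j (i + k) 0 0; set y5 := F i k 0 0 => J.
have nz : 2%:R * j%:~R * ((i + j + k)%:~R + C) != 0.
  by rewrite !mulf_neq0 ?okC.
apply: (mulfI nz).
apply: (eq_of_sub_eq (J 1 0 0 +E J (- 1) 0 0 +E - 2%:R *E J 0 0 0)).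
ring.
Qed.

(** An arrow followed by its reverse has slope 1, that of [L_0]. The relation at [k] passes through
    [- i + k]; if that vertex is excluded, the relation at [i + k] passes through [2 i + k]
    instead. *)
Lemma slope_neq0 i k : ok k -> ok (i + k) -> slope i k != 0.
Proof.
move=> k0 ik; have slope0 k' : slope 0 k' = 1 by rewrite /slope eqxx.
have [->|i0] := eqVneq i 0; first by rewrite slope0 oner_neq0.
have [ki|ki] := boolP (ok (- i + k)).
  have := @slopeM (- i) i k; rewrite addNr add0r => /(_ k0 ki ik k0) H.
  by apply: contra_eq_neq H => ->; rewrite mulr0 slope0 oner_neq0.
have kii : ok (i + (i + k)) by move: ki k0 ik i0; rewrite /ok; lia.
have := @slopeM i (- i) (i + k); rewrite addrN add0r addKr.
move=> /(_ ik kii k0 ik) H.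
by apply: contra_eq_neq H => ->; rewrite mul0r slope0 oner_neq0.
Qed.

(** A cocycle is a coboundary: [psi k] is the slope from vertex 1 to [k]. The relation passes
    through [i + 1], so [i = - 1] is treated apart when 0 is excluded: the step from [k - 1] to [k]
    is split off and inverted. *)
Lemma slope_gauge : exists2 psi : int -> K, (forall k, psi k != 0) &
  forall i k, ok k -> ok (i + k) -> slope i k * psi k = psi (i + k).
Proof.
have slope0 k : slope 0 k = 1 by rewrite /slope eqxx.
have ok1 : ok 1 by rewrite /ok orbT.
have ok2 : ok 2 by rewrite /ok orbT.
exists (fun k => if ok k then slope (k - 1) 1 else 1) => [k|i k k0 ik].
  by case: ifP => kok; rewrite ?oner_neq0 ?slope_neq0 ?subrK.
rewrite k0 ik.
have [i1|i1] := boolP (ok (i + 1)).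
  have := @slopeM i (k - 1) 1; rewrite subrK -addrA subrK addrA.
  by move=> /(_ ok1 i1 k0 ik).
have iN1 : i = - 1 by move: i1; rewrite /ok; lia.
rewrite iN1 in ik i1 *.
have inv : slope (- 1) k * slope 1 (- 1 + k) = 1.
  have [k1|k1] := boolP (ok (1 + k)).
    by rewrite mulrC -slopeM ?slope0 ?add0r ?subrr.
  have k3 : ok (- 1 + (- 1 + k)) by move: k1 k0 ik i1; rewrite /ok; lia.
  by have := @slopeM (- 1) 1 (- 1 + k); rewrite addNr add0r addNKr slope0 => ->.
have -> : slope (k - 1) 1 = slope 1 (- 1 + k) * slope (- 1 + k - 1) 1.
  have E : k - 1 = 1 + (- 1 + k - 1) by lia.
  rewrite [in LHS]E slopeM ?subrK //.
  by rewrite -addrA subrK addrA addrN add0r.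
by rewrite mulrA inv mul1r.
Qed.

(** * The additive constants [y_(i,k)] of the arrows *)

Definition offset i k := F i k 0 0 / slope i k.

Lemma edge_offset i k l d : ok k -> ok (i + k) ->
  F i k l d = slope i k * (i%:~R * d + ((i + k)%:~R + C) * l + offset i k).
Proof.
move=> k0 ik; rewrite edgeE ?okC // /offset [RHS]mulrDr mulrCA divff ?mulr1 //.
exact: slope_neq0.
Qed.

(** By the cocycle relation both products of slopes on the right equal [slope (i + j) k], which
    cancels. *)
Lemma offset_jacobi i j k l m d :
  ok k -> ok (i + k) -> ok (j + k) -> ok (i + j + k) ->
  (j%:~R * l - i%:~R * m) * ((i + j)%:~R * d
    + ((i + j + k)%:~R + C) * (l + m) + offset (i + j) k) =
  (i%:~R * d + ((i + j + k)%:~R + C) * l + offset i (j + k)) *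
  (j%:~R * (d + l) + ((j + k)%:~R + C) * m + offset j k) -
  (j%:~R * d + ((i + j + k)%:~R + C) * m + offset j (i + k)) *
  (i%:~R * (d + m) + ((i + k)%:~R + C) * l + offset i k).
Proof.
move=> k0 ik jk ijk; have ijk' : ok (j + i + k) by rewrite [j + i]addrC.
apply: (mulfI (slope_neq0 k0 ijk)).
have S1 := slopeM k0 ik jk ijk; have S2 := slopeM k0 jk ik ijk'.
rewrite [j + i]addrC in S2.
set A := i%:~R * d + _ + _; set A' := j%:~R * (d + l) + _ + _.
set B := j%:~R * d + _ + _; set B' := i%:~R * (d + m) + _ + _.
have := pJ i j k l m d; rewrite !edge_offset //; last 2 first.
- by rewrite addrCA addrA.
- by rewrite addrA.
rewrite (addrCA j i k) (addrA i j k) -/A -/A' -/B -/B' => H.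
apply: (eq_of_sub_eq (H +E - (A * A') *E S1 +E B * B' *E S2)); ring.
Qed.

(** In order: the coefficient of [d], the coefficient of [l] and the constant term of
    [offset_jacobi]. Differences of values at 1 and -1 isolate the odd parts. *)
Lemma offset_rel i j k :
  ok k -> ok (i + k) -> ok (j + k) -> ok (i + j + k) ->
  [/\ j%:~R * (offset i (j + k) - offset i k)
      = i%:~R * (offset j (i + k) - offset j k),
     j%:~R * offset (i + j) k = j%:~R * offset i (j + k)
       + ((i + j + k)%:~R + C) * offset j k - ((i + k)%:~R + C) * offset j (i + k)
   & offset i (j + k) * offset j k = offset j (i + k) * offset i k].
Proof.
move=> k0 ik jk ijk; have J l m d := offset_jacobi l m d k0 ik jk ijk.
have R3 : offset i (j + k) * offset j k = offset j (i + k) * offset i k.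
  by apply: (eq_of_sub_eq (- 1 *E J 0 0 0)); ring.
have R2 : j%:~R * offset (i + j) k = j%:~R * offset i (j + k)
    + ((i + j + k)%:~R + C) * offset j k - ((i + k)%:~R + C) * offset j (i + k).
  apply: (mulfI (_ : 2%:R != 0)); first by rewrite natr_eq0_pchar0.
  by apply: (eq_of_sub_eq (J 1 0 0 +E - 1 *E J (- 1) 0 0)); ring.
split=> //.
apply: (mulfI (_ : 2%:R != 0)); first by rewrite natr_eq0_pchar0.
by apply: (eq_of_sub_eq (- 1 *E J 0 0 1 +E J 0 0 (- 1))); ring.
Qed.

Lemma offset0 k : offset 0 k = 0.
Proof. by rewrite /offset p0E mulr0 mul0r. Qed.

(** The indices [i] and [- i] add up to 0, and [L_0] has offset 0. With [t] the change of the offset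
    of [L_i] between [k] and [- i + k], elimination gives [(k + C) t ^ 2 = 0]. *)
Lemma offset_opp i k : ok k -> ok (i + k) -> ok (- i + k) ->
  offset i (- i + k) = offset i k /\ offset (- i) k = - offset i k.
Proof.
move=> k0 ik jk; have [->|i0] := eqVneq i 0.
  by rewrite oppr0 add0r offset0 oppr0.
have iK : i%:~R != 0 :> K by rewrite intr_eq0_pchar0.
have [|] := @offset_rel i (- i) k k0 ik jk; first by rewrite addrN add0r.
rewrite addrN add0r offset0 rmorphN /=.
move: (offset i (- i + k)) (offset i k) (offset (- i) (i + k)) (offset (- i) k).
move=> u' u v' v R1 R2 R3.
have v'E : v' = v - (u' - u).
  by apply: (mulfI iK); apply: (eq_of_sub_eq (- 1 *E R1)); ring.
rewrite {}v'E in R1 R2 R3.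
have t0 : (u' - u) * (u' - u) = 0.
  apply: (mulfI (okC k0)).
  apply: (eq_of_sub_eq (- (u' - u) *E R2 +E i%:~R *E R3)).
  ring.
have {t0}uu : u' = u.
  by apply/eqP; rewrite -subr_eq0; move/eqP: t0; rewrite mulf_eq0 orbb.
split=> //; apply: (mulfI iK); rewrite uu in R2.
by apply: (eq_of_sub_eq R2); ring.
Qed.

(** [offset_opp] makes the offset of [L_1] constant along consecutive arrows. Excluding the vertex 0
    leaves two half-lines, which [neg2] joins. *)
Lemma offset1 k : ok k -> ok (1 + k) -> offset 1 k = offset 1 1.
Proof.
have pos (n : nat) : offset 1 n.+1 = offset 1 1.
  elim: n => [//|n <-].
  have [||| <- _] := @offset_opp 1 n.+2; try by rewrite /ok; lia.
  by congr (offset 1 _); lia.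
have neg (n : nat) : offset 1 (- 2 - n%:Z) = offset 1 (- 2).
  elim: n => [|n <-]; first by rewrite subr0.
  have [||| <- _] := @offset_opp 1 (- 2 - n%:Z); try by rewrite /ok; lia.
  by congr (offset 1 _); lia.
(* [L_(- 4)] and [L_(- 3)] carry vertex 1 across 0. Eliminating their offsets leaves [1 + C], which
   is nonzero, times the square of the difference sought. *)
have neg2 : offset 1 (- 2) = offset 1 1.
  have [||||R1 R2 R3] := @offset_rel (- 4) 1 1; try by rewrite /ok; lia.
  have [||||R1' _ R3'] := @offset_rel (- 3) 1 1; try by rewrite /ok; lia.
  have ok1 : ok 1 by rewrite /ok orbT.
  rewrite -[offset 1 (- 4 + 1)]/(offset 1 (- 2 - 1%:Z)) neg in R1 R2 R3.
  rewrite -[offset (- 4 + 1) 1]/(offset (- 3) 1) in R2.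
  rewrite -[offset 1 (- 3 + 1)]/(offset 1 (- 2)) in R1' R3'.
  have tt : (offset 1 (- 2) - offset 1 1) * (offset 1 (- 2) - offset 1 1) = 0.
    apply: (mulfI (okC ok1)).
    move: (offset 1 (- 2)) (offset 1 1) (offset (- 4) 1) (offset (- 3) 1)
      (offset (- 4) (1 + 1)) (offset (- 3) (1 + 1)) R1 R2 R3 R1' R3'.
    move=> D' D a a' b b' R1 R2 R3 R1' R3'.
    apply: (eq_of_sub_eq ((D' - D + D) *E R1 +E (D' - D) *E R2 +E - 1 *E R3
      +E - D *E R1' +E R3')).
    ring.
  by apply/eqP; rewrite -subr_eq0; move/eqP: tt; rewrite mulf_eq0 orbb.
have [f|nf] := boolP full; last first.
  case: k => [[|k]|[|k]] k0 k1; try by move: k0 k1; rewrite /ok; lia.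
    exact: pos.
  by rewrite -neg2 -(neg k); congr (offset 1 _); lia.
have step m : offset 1 (m + 1) = offset 1 m.
  have [||| <- _] := @offset_opp 1 (m + 1); try by rewrite /ok; lia.
  by congr (offset 1 _); lia.
elim: k => [|k IH|k IH] _ _.
- by rewrite -(step 0).
- by rewrite -[k.+1%:Z]/(1 + k%:Z) addrC step IH // /ok f.
by rewrite -step addrC -[- k.+1%:Z]/(- (1 + k%:Z)) opprD addNKr IH // /ok f.
Qed.

Lemma offset_step i k : ok k -> ok (1 + k) -> ok (i + k) -> ok (i + 1 + k) ->
  offset i (1 + k) = offset i k /\ offset (i + 1) k = offset i k + offset 1 1.
Proof.
move=> k0 k1 ik ik1; have [||||+ + _] := @offset_rel i 1 k => //.
rewrite !mul1r !offset1 //; last by rewrite addrCA addrA.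
rewrite subrr mulr0 => /eqP; rewrite subr_eq0 => /eqP R1 R2; split=> //.
by rewrite R2 R1 !rmorphD /=; ring.
Qed.

Lemma offset_path (n : nat) k : ok k -> ok (1 + k) ->
  ((forall t : nat, (t <= n)%N -> ok (t%:Z + k)) ->
     offset n%:Z k = n%:~R * offset 1 1) /\
  ((forall t : nat, (t <= n)%N -> ok (- t%:Z + k)) ->
     offset (- n%:Z) k = - n%:~R * offset 1 1).
Proof.
move=> k0 k1; split; elim: n => [|n IH] kt; rewrite ?oppr0 ?offset0 ?mul0r //.
  have [||||_] := @offset_step n%:Z k => //.
  - exact: kt.
  - by have := kt n.+1 (leqnn _); rewrite -[n.+1%:Z]/(1 + n%:Z) [1 + _]addrC.
  rewrite [n%:Z + 1]addrC -[1 + n%:Z]/(n.+1%:Z) => ->; rewrite IH; last first.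
    by move=> t tn; apply: kt; apply: leqW.
  by rewrite -[n.+1%:Z]/(1 + n%:Z) rmorphD /=; ring.
have E : - n.+1%:Z + 1 = - n%:Z by lia.
have [||||_] := @offset_step (- n.+1%:Z) k => //.
- exact: kt.
- by rewrite E; apply: kt.
rewrite E IH; last by move=> t tn; apply: kt; apply: leqW.
move=> H; apply: (eq_of_sub_eq (- 1 *E H)).
by rewrite -[n.+1%:Z]/(1 + n%:Z) rmorphD /=; ring.
Qed.

(* Paths staying on one side of the vertex 0 give the result when k and i + k
   have the same sign; [offset_opp] reduces the other case to it. *)
Lemma offsetE i k : ok k -> ok (i + k) -> offset i k = i%:~R * offset 1 1.
Proof.
have same_pos i' k' : ok k' -> ok (1 + k') ->
    full || (0 < k') && (0 < i' + k') || (k' < 0) && (i' + k' < 0) ->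
    offset i' k' = i'%:~R * offset 1 1.
  move=> k0 k1 ik; case: (intP i') ik => [|n|n] ik.
  - by rewrite offset0 mul0r.
  - have [+ _] := @offset_path n.+1 k' k0 k1; apply=> t tn.
    by move: k0 k1 ik; rewrite /ok; lia.
  have [_ +] := @offset_path n.+1 k' k0 k1; rewrite rmorphN /=; apply=> t tn.
  by move: k0 k1 ik; rewrite /ok; lia.
have same i' k' : ok k' ->
    full || (0 < k') && (0 < i' + k') || (k' < 0) && (i' + k' < 0) ->
    offset i' k' = i'%:~R * offset 1 1.
  move=> k0 ik; have [k1|k1] := boolP (ok (1 + k')); first exact: same_pos.
  (* [same_pos] needs the vertex [1 + k'], which is excluded here; the offset is computed from the
     vertex -2 instead. *)
  have kN1 : k' = - 1 by move: k1; rewrite /ok; lia.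
  have nf : ~~ full by move: k1; rewrite /ok; lia.
  rewrite kN1 in ik *; have [||||H _] := @offset_step i' (- 2);
    try by move: ik; rewrite /ok; lia.
  have {}H : offset i' (- 1) = offset i' (- 2) by exact: H.
  by rewrite H; apply: same_pos; move: ik; rewrite /ok; lia.
move=> k0 ik.
have [s|ns] := boolP (full || (0 < k) && (0 < i + k) || (k < 0) && (i + k < 0)).
  exact: same.
have [|||_] := @offset_opp (- i) k => //.
- by move: ns ik k0; rewrite /ok; lia.
- by rewrite opprK.
rewrite opprK => ->; rewrite same //; last by move: ns ik k0; rewrite /ok; lia.
by rewrite rmorphN /= mulNr opprK.
Qed.

End Edges.

(** * Classification of the coefficients *)

(* [q] is obtained from [p] by replacing the basis (v_k) by (c_k v_(k + s)). *)
Definition rescaling (K : fieldType) (p q : int -> int -> {poly {poly K}}) :=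
  exists (s : int) (c : int -> K), (forall k, c k != 0) /\
    forall i j, cstP (c (i + j)) * q i j = cstP (c j) * p i (j + s).

Section CoefficientValues.
Variable K : fieldType.
Implicit Types (C D l d : K) (i j : int).

Lemma V_CD_coefE C D i j l d : (V_CD_coef C D i j).[l%:P].[d] =
  ((i + j)%:~R + C) * l + i%:~R * (d + D).
Proof. by rewrite /V_CD_coef /cstP /intP /lamP /derP /cstP !hornerE. Qed.

Lemma V_D_coefE D i j l d :
  (V_D_coef D i j).[l%:P].[d] = V_D_value d l D i j.
Proof.
rewrite /V_D_coef /V_D_value; do 2?case: ifP => _;
  by rewrite /intP /lamP /derP /cstP !(hornerE, horner_exp) // addrAC.
Qed.

Lemma V'_D_coefE D i j l d :
  (V'_D_coef D i j).[l%:P].[d] = V'_D_value d l D i j.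
Proof.
rewrite /V'_D_coef /V'_D_value; do 2?case: ifP => _;
  by rewrite /intP /lamP /derP /cstP !(hornerE, horner_exp).
Qed.

End CoefficientValues.

Section Classification.
Variable K : fieldType.
Hypothesis K0 : [pchar K] =i pred0.
Implicit Types (p q : int -> int -> {poly {poly K}}) (g h : {poly K}).

Lemma poly2_ext (u v : {poly {poly K}}) :
  (forall l d : K, u.[l%:P].[d] = v.[l%:P].[d]) -> u = v.
Proof.
move=> uv; apply: (can_inj swapXYK); apply/polyP => i.
apply: (poly_ext_pchar0 K0) => l; rewrite -!coef_hornerC.
by suff -> : u.[l%:P] = v.[l%:P] by []; apply: (poly_ext_pchar0 K0).
Qed.

Lemma rescalingI p q s (c : int -> K) : (forall k, c k != 0) ->
  (forall i j l d, c (i + j) * (q i j).[l%:P].[d] =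
                   c j * (p i (j + s)).[l%:P].[d]) ->
  rescaling p q.
Proof.
move=> c0 qp; exists s, c; split=> // i j; apply: poly2_ext => l d.
by rewrite /cstP !hornerM !hornerC qp.
Qed.

(** Rescaling by [slope_gauge] turns the slopes into 1, and [D] is the offset of [L_1] at vertex
    1. *)
Lemma edge_form p C (full : bool) : jacobi_coef p ->
  (forall k l d, (p 0 k).[l%:P].[d] = (k%:~R + C) * l) ->
  (forall k, ok full k -> k%:~R + C != 0) ->
  exists (c : int -> K) (D : K), (forall k, c k != 0) /\
    forall i k l d, ok full k -> ok full (i + k) ->
      c k * (p i k).[l%:P].[d] =
      c (i + k) * (i%:~R * (d + D) + ((i + k)%:~R + C) * l).
Proof.
move=> pJ p0E okC; have [c c0 cE] := slope_gauge K0 pJ p0E okC.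
exists c, (offset p 1 1); split=> // i k l d k0 ik.
rewrite (edge_offset K0 pJ p0E okC) // (offsetE K0 pJ p0E okC) // -cE //.
ring.
Qed.

(** Every index compares with 1 directly except -1, which does so through 2. *)
Lemma proportional_family (f : int -> {poly K}) :
  (forall i j, i != 0 -> j != 0 -> i + j != 0 ->
     j%:~R *: f i = i%:~R *: f j) ->
  forall i, i != 0 -> f i = i%:~R *: f 1.
Proof.
move=> fE i i0; have [->|i1] := eqVneq i (- 1).
  have E1 := fE (- 1) 2 isT isT isT; have := fE 2 1 isT isT isT.
  rewrite scale1r => E2; move: E1; rewrite E2 scalerA => E1.
  have two : 2%:~R != 0 :> K by rewrite intr_eq0_pchar0.
  by apply: (scalerI two); rewrite E1 scalerA mulrC.
by rewrite -(fE i 1) ?scale1r // addr_eq0.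
Qed.

(** ['X] is the only prime factor, so [g] is a unit times a power of ['X]. *)
Lemma factor_Xsqr g h : g * h = 'X^2 ->
  exists2 c, c != 0 & [\/ g = c%:P /\ h = c^-1 *: 'X^2,
    g = c *: 'X /\ h = c^-1 *: 'X | g = c *: 'X^2 /\ h = c^-1%:P].
Proof.
move=> gh; have X0 : 'X - 0%:P = 'X :> {poly K} by rewrite subr0.
have : g %| ('X - 0%:P) ^+ 2 by rewrite X0 -gh dvdp_mulr.
case/dvdp_exp_XsubCP => k k2 /eqpf_eq [c c0]; rewrite X0 => gE.
exists c => //.
have hE n : (k + n = 2)%N -> h = c^-1 *: 'X^n.
  move=> kn; have /mulfI : c *: 'X^k != 0 :> {poly K}.
    by rewrite scaler_eq0 negb_or c0 monic_neq0 ?monicXn.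
  apply; rewrite -gE gh gE -scalerAl -scalerAr scalerA divff // scale1r.
  by rewrite -exprD kn.
case: k k2 gE hE => [|[|[|//]]] _ -> hE.
- by constructor 1; rewrite (hE 2) // expr0 alg_polyC.
- by constructor 2; rewrite (hE 1%N).
by constructor 3; rewrite (hE 0%N) // expr0 alg_polyC.
Qed.

(** * Arrows out of and into the vertex of weight 0 *)

Section IntegralWeights.
Variable p : int -> int -> {poly {poly K}}.
Hypothesis pJ : jacobi_coef p.
Hypothesis p0E : forall k l d, (p 0 k).[l%:P].[d] = k%:~R * l.
Variables (c : int -> K) (D : K).
Hypothesis c0 : forall k, c k != 0.
Local Notation F i j l d := (p i j).[l%:P].[d].
Hypothesis cE : forall i k l d, k != 0 -> i + k != 0 ->
  c k * F i k l d = c (i + k) * (i%:~R * (d + D) + (i + k)%:~R * l).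

Let p0E' k l d : F 0 k l d = (k%:~R + 0) * l.
Proof. by rewrite addr0 p0E. Qed.

(* p_(i,0) = c_i g_i(lambda + d + D) and p_(i,-i) = h_i(d + D) / c_(-i) for
   g_i = [source0 i] and h_i = [target0 i]. *)
Definition source0 (i : int) : {poly K} :=
  (c i)^-1 *: ((p i 0).[0%:P] \Po ('X - D%:P)).

Definition target0 (i : int) : {poly K} :=
  c (- i) *: ((p i (- i)).[0%:P] \Po ('X - D%:P)).

(** The source has weight 0, so one term of [coef_from_lambda0] drops out and lambda and d enter
    only through their sum. *)
Lemma source0E i l d : i != 0 ->
  F i 0 l d = c i * (source0 i).[d + l + D].
Proof.
move=> i0; have iK : i%:~R != 0 :> K by rewrite intr_eq0_pchar0.
rewrite hornerZ horner_comp hornerD hornerN hornerX hornerC addrK mulVKf //.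
apply: (mulfI iK); rewrite (coef_from_lambda0 pJ p0E') addr0; ring.
Qed.

(** The target has weight 0, so the other term drops out and lambda does not occur. *)
Lemma target0E i l d : i != 0 ->
  c (- i) * F i (- i) l d = (target0 i).[d + D].
Proof.
move=> i0; have iK : i%:~R != 0 :> K by rewrite intr_eq0_pchar0.
rewrite hornerZ horner_comp hornerD hornerN hornerX hornerC addrK.
congr (_ * _); apply: (mulfI iK).
by rewrite (coef_from_lambda0 pJ p0E') addrN rmorphN /=; ring.
Qed.

Lemma edge_val i k l d : k != 0 -> i + k != 0 ->
  F i k l d = c (i + k) / c k * (i%:~R * (d + D) + (i + k)%:~R * l).
Proof.
by move=> k0 ik; apply: (mulfI (c0 k)); rewrite cE // mulrA mulrCA divff // mulr1.
Qed.

(** The axiom for [i], [j] at 0 with [l = m = 0] compares the routes through [i] and [j]; the common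
    factor [x = d + D] is removed by cancelling ['X]. *)
Lemma source0_lin i : i != 0 -> source0 i = i%:~R *: source0 1.
Proof.
move: i; apply: proportional_family => i j i0 j0 ij0.
apply: (mulfI (_ : 'X != 0)); first by rewrite polyX_eq0.
apply: (poly_ext_pchar0 K0) => x; rewrite !(hornerM, hornerX).
rewrite (hornerZ j%:~R) (hornerZ i%:~R).
have := pJ i j 0 0 0 (x - D).
rewrite !addr0 !mulr0 subrr mul0r !source0E // !edge_val //;
  last by rewrite addrC.
rewrite !addr0 !mulr0 !addr0 subrK [j + i]addrC => H.
apply: (mulfI (c0 (i + j))); apply: (eq_of_sub_eq H).
by field; rewrite !c0.
Qed.

(** The mirror argument, with two routes from [- (i + j)] into 0. *)
Lemma target0_lin i : i != 0 -> target0 i = i%:~R *: target0 1.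
Proof.
move: i; apply: proportional_family => i j i0 j0 ij0.
apply: (mulfI (_ : 'X != 0)); first by rewrite polyX_eq0.
apply: (poly_ext_pchar0 K0) => x; rewrite !(hornerM, hornerX).
rewrite (hornerZ j%:~R) (hornerZ i%:~R).
have ik : i - (i + j) = - j by rewrite opprD addNKr.
have jk : j - (i + j) = - i by rewrite [i + j]addrC opprD addNKr.
have k0 : - (i + j) != 0 by rewrite oppr_eq0.
have := pJ i j (- (i + j)) 0 0 (x - D).
rewrite !addr0 !mulr0 subrr mul0r ik jk.
have tE m : m != 0 -> F m (- m) 0 (x - D) = (c (- m))^-1 * (target0 m).[x].
  by move=> m0; rewrite -{2}[x](subrK D) -(target0E 0) // mulKf.
rewrite !tE // !edge_val ?ik ?jk ?oppr_eq0 // !mulr0 !addr0 subrK => H.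
apply: (mulfI (_ : (c (- (i + j)))^-1 != 0)); first by rewrite invr_eq0.
by apply: (eq_of_sub_eq (esym H)); field; rewrite !c0.
Qed.

(** At [l = m = 0], the loop from vertex 1 through 0 equals the loop through 2, whose arrows are
    known. *)
Lemma source0_target0 : source0 1 * target0 1 = 'X^2.
Proof.
apply: (poly_ext_pchar0 K0) => x; rewrite hornerM hornerXn.
have := pJ 1 (- 1) 1 0 0 (x - D).
rewrite !addr0 !mulr0 subrr mul0r addNr.
have tE : F (- 1) 1 0 (x - D) = (c 1)^-1 * (target0 (- 1)).[x].
  by rewrite -{2}[x](subrK D) -(target0E 0) // opprK mulKf.
rewrite source0E // tE target0_lin // !edge_val // addr0 subrK !mulr0 !addr0.
rewrite (hornerZ (- 1)%:~R) => H.
apply: (eq_of_sub_eq H); field.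
by rewrite !c0.
Qed.

Lemma classification_integral : [\/ exists C D, rescaling p (V_CD_coef C D),
  exists D, rescaling p (V_D_coef D) | exists D, rescaling p (V'_D_coef D)].
Proof.
have [a a0 cases] := factor_Xsqr source0_target0.
(* [cE] does not constrain [c 0]; the value [a^-1] absorbs the constant of the factorization. *)
pose c' k := if k == 0 then a^-1 else c k.
have c'0 k : c' k != 0 by rewrite /c'; case: ifP; rewrite ?invr_eq0.
have tE k l d : k != 0 -> c k * F (- k) k l d = (- k)%:~R * (target0 1).[d + D].
  by move=> k0; rewrite -(hornerZ (- k)%:~R) -target0_lin ?oppr_eq0 //
    -(target0E l) ?oppr_eq0 // opprK.
have sE i l d : i != 0 -> F i 0 l d = c i * (i%:~R * (source0 1).[d + l + D]).
  by move=> i0; rewrite source0E // source0_lin // (hornerZ i%:~R).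
have rescale q : (forall i j l d, j != 0 -> i + j != 0 ->
    (q i j).[l%:P].[d] = i%:~R * (d + D) + (i + j)%:~R * l) ->
  (forall l d, (q 0 0).[l%:P].[d] = 0) ->
  (forall i l d, i != 0 -> (q i 0).[l%:P].[d] =
    a^-1 * (i%:~R * (source0 1).[d + l + D])) ->
  (forall k l d, k != 0 -> (q (- k) k).[l%:P].[d] =
    a * ((- k)%:~R * (target0 1).[d + D])) ->
  rescaling p q.
  move=> q1 q2 q3 q4; apply: (@rescalingI p q 0 c') => // i j l d; rewrite addr0.
  have [->|j0] := eqVneq j 0.
    rewrite addr0; have [->|i0] := eqVneq i 0; first by rewrite q2 p0E mul0r.
    by rewrite q3 // sE // /c' eqxx (negPf i0); ring.
  have [ij|ij] := eqVneq (i + j) 0.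
    have -> : i = - j by apply/eqP; rewrite -addr_eq0 ij.
    by rewrite q4 // addNr /c' eqxx (negPf j0) tE // mulKf.
  by rewrite q1 // /c' (negPf j0) (negPf ij) cE.
case: cases => -[gE hE].
- constructor 3; exists D; apply: rescale => [i j l d j0 ij|l d|i l d i0|k l d
  k0];
    rewrite V'_D_coefE /V'_D_value ?gE ?hE ?(hornerC, hornerZ, hornerX,
      hornerXn) ?j0 ?ij ?eqxx ?addNr /=.
  + by rewrite addrC.
  + by [].
  + by field.
  + by rewrite k0 /= (negPf k0); field.
- constructor 1; exists 0, D; apply: rescale => [i j l d j0 ij|l d|i l d i0|k l
  d k0];
    rewrite V_CD_coefE ?gE ?hE ?(hornerC, hornerZ, hornerX, hornerXn) ?addr0
      ?addNr ?addr0.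
  + by ring.
  + by ring.
  + by field.
  + by field.
- constructor 2; exists D; apply: rescale => [i j l d j0 ij|l d|i l d i0|k l d
  k0];
    rewrite V_D_coefE /V_D_value ?gE ?hE ?(hornerC, hornerZ, hornerX, hornerXn)
      ?j0 ?ij ?eqxx ?addNr /=.
  + by ring.
  + by ring.
  + by field.
  + by rewrite k0 /= (negPf k0); field.
Qed.
End IntegralWeights.

Lemma jacobi_coef_shift p s : jacobi_coef p ->
  jacobi_coef (fun i j => p i (j + s)).
Proof. by move=> pJ i j k l m d; have := pJ i j (k + s) l m d;
  rewrite !addrA. Qed.

Lemma rescaling_shift p q s : rescaling (fun i j => p i (j + s)) q ->
  rescaling p q.
Proof.
move=> [t [c [c0 cE]]]; exists (t + s), c; split=> // i j.
by rewrite cE addrA.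
Qed.

Theorem classification p : jacobi_coef p -> (exists i j, p i j != 0) ->
  [\/ exists C D, rescaling p (V_CD_coef C D),
     exists D, rescaling p (V_D_coef D) | exists D, rescaling p (V'_D_coef D)].
Proof.
move=> pJ p0; have [C CE] := weight_linear K0 pJ p0.
have p0E k l d : (p 0 k).[l%:P].[d] = (k%:~R + C) * l.
  by rewrite (weightE K0 pJ) hornerC CE.
have [[s sC]|nC] := EM (exists s : int, s%:~R + C = 0).
  (* Reindexing moves the vertex [s] of weight 0 to 0, so that the new [C] is 0. *)
  pose q i j := p i (j + s).
  have qJ : jacobi_coef q by apply: jacobi_coef_shift.
  have q0E k l d : (q 0 k).[l%:P].[d] = (k%:~R + 0) * l.
    by rewrite p0E rmorphD -addrA sC.
  have okC k : ok false k -> k%:~R + 0 != 0 :> K.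
    by rewrite addr0 intr_eq0_pchar0.
  have [c [D [c0 cE]]] := edge_form qJ q0E okC.
  have [||[C' [D' r]]|[D' r]|[D' r]] := @classification_integral q qJ _ c D c0.
  - by move=> k l d; rewrite q0E addr0.
  - by move=> i k l d k0 ik; rewrite cE // addr0.
  - by constructor 1; exists C', D'; apply: rescaling_shift r.
  - by constructor 2; exists D'; apply: rescaling_shift r.
  - by constructor 3; exists D'; apply: rescaling_shift r.
have okC k : ok true k -> k%:~R + C != 0.
  by move=> _; apply/eqP => kC; apply: nC; exists k.
have [c [D [c0 cE]]] := edge_form pJ p0E okC.
constructor 1; exists C, D; apply: (rescalingI c0 (s := 0)) => i j l d.
by rewrite addr0 cE // V_CD_coefE; congr (_ * _); apply: addrC.
Qed.

End Classification.

(** * From modules to coefficients and back *)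

Section GradedBases.
Variables (K : fieldType) (V : conformalModule (B K)).
Implicit Types (G : int -> V -> Prop) (w : int -> V) (a v x : freeZ K) (y z : V).
Implicit Types (p q : int -> int -> {poly {poly K}}).

Definition graded_basis G w := is_grading G /\ forall j : int,
  [/\ G j (w j), forall y, G j y -> exists f : {poly K}, y = f *: w j
    & forall f : {poly K}, f *: w j = 0 -> f = 0].

Definition acts_by w p := forall (i j : int) (n : nat),
  (lact (<< i >> : B K) (w j))@_n = (p i j)`_n *: w (i + j).

Lemma graded_basis_rescale G w (s : int) (c : int -> K) :
  graded_basis G w -> (forall k, c k != 0) ->
  graded_basis (fun j => G (j + s)) (fun j => (c j)%:P *: w (j + s)).
Proof.
case=> -[G0 GD GZ Gsum Gdir] wG c0.
have cK k : (c k)%:P * (c k)^-1%:P = 1 by rewrite -polyCM divff.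
split.
  split=> [i|i|i|x|r y ur yG y0 i ir]; [exact: G0|exact: GD|exact: GZ| |].
    have [r [y [ur yG ->]]] := Gsum x.
    exists [seq i - s | i <- r], (fun i => y (i + s)); split=> //.
      by rewrite map_inj_uniq //; apply: addIr.
    by rewrite big_map; apply: eq_bigr => i _; rewrite subrK.
  have := Gdir [seq i + s | i <- r] (fun i => y (i - s)).
  move=> /(_ _ _ _ (i + s)); rewrite addrK; apply.
  - by rewrite map_inj_uniq //; apply: addIr.
  - by move=> k; have := yG (k - s); rewrite subrK.
  - by rewrite big_map -[RHS]y0; apply: eq_bigr => k _; rewrite addrK.
  by apply/mapP; exists i.
move=> j; have [wj wE w0] := wG (j + s); split=> [|x /wE [f ->]|f].
- exact: GZ.
- by exists (f * (c j)^-1%:P); rewrite scalerA -mulrA [_^-1%:P * _]mulrC cK mulr1.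
rewrite scalerA => /w0 /(congr1 (fun g => g * (c j)^-1%:P)).
by rewrite -mulrA cK mulr1 mul0r.
Qed.

Section Coordinates.
Variables (G : int -> V -> Prop) (w : int -> V).
Hypothesis wG : graded_basis G w.

Definition combination x : V := \sum_(i <- msupp x) x@_i *: w i.

Lemma combinationU f i : combination << f *g i >> = f *: w i.
Proof.
apply: (@msumU _ _ _ (fun i f => f *: w i)) => k f1 f2; exact: scalerDl.
Qed.

Lemma combination_is_linear : linear combination.
Proof.
have D (x1 x2 : freeZ K) : combination (x1 + x2) =
  combination x1 + combination x2.
  by apply: (@msumD _ _ _ (fun i f => f *: w i)) => k f1 f2; apply: scalerDl.
have c0 : combination 0 = 0 by apply: (addrI (combination 0)); rewrite -D !addr0.
move=> f x y; rewrite D; congr (_ + _).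
elim/malg_ind: x => [|x1 x2 IH1 IH2|g i].
- by rewrite scaler0 c0 scaler0.
- by rewrite scalerDr !D IH1 IH2 scalerDr.
by rewrite freeZ_scaleU !combinationU scalerA.
Qed.

HB.instance Definition _ := GRing.isLinear.Build {poly K} (freeZ K) V _
  combination combination_is_linear.

Lemma combination_inj : injective combination.
Proof.
case: wG => -[_ _ GZ _ Gdir] wb; apply: raddf_inj => x x0.
apply/malgP => i; rewrite mcoeff0.
have [ix|/mcoeff_outdom //] := boolP (i \in msupp x).
have [_ _] := wb i; apply.
apply: (Gdir (msupp x) (fun i => x@_i *: w i)) => //; first exact: fset_uniq.
by move=> k; have [wk _ _] := wb k; apply: GZ.
Qed.

Lemma combination_surj y : exists x, combination x = y.
Proof.
case: wG => -[_ _ _ Gsum _] wb; have [r [z [_ zG ->]]] := Gsum y.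
have /choice [f fE] : forall i, exists f, z i = f *: w i.
  by move=> i; have [_ wE _] := wb i; apply: wE.
exists (\sum_(i <- r) << f i *g i >>); rewrite raddf_sum.
by apply: eq_bigr => i _; rewrite [LHS]combinationU fE.
Qed.

Lemma acts_by_exists :
  (forall (i j : int) (f : {poly K}) (v : V) (n : nat),
     G j v -> G (i + j) (lact (f *: << i >> : B K) v)@_n) ->
  exists p, acts_by w p.
Proof.
move=> actG.
have coefs (ij : int * int) : exists q : {poly {poly K}}, forall n,
    (lact (<< ij.1 >> : B K) (w ij.2))@_n = q`_n *: w (ij.1 + ij.2).
  case: ij => i j /=; set u := lact _ _; case: wG => _ wb.
  have /choice [f fE] : forall n, exists f, u@_n = f *: w (i + j).
    move=> n; have [_ wE _] := wb (i + j); apply: wE.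
    by have [wj _ _] := wb j; have := actG i j 1 (w j) n wj; rewrite scale1r.
  (* The support in lambda is finite, and its maximum bounds the degree. *)
  exists (\poly_(n < (\max_(k <- msupp u) k).+1) f n) => n.
  rewrite coef_poly; case: ltnP => [_|un]; first exact: fE.
  rewrite scale0r mcoeff_outdom //; apply: contraL un => nu.
  by rewrite -ltnNge ltnS (leq_bigmax_seq _ nu).
have [q qE] := choice coefs.
by exists (fun i j => q (i, j)) => i j n; apply: (qE (i, j)).
Qed.

Variable p : int -> int -> {poly {poly K}}.
Hypothesis wp : acts_by w p.

Let lactP := @lact_product K (B K) V.

Lemma lact0l y : lact (0 : B K) y = 0 :> lpoly V.
Proof. by apply: (addrI (lact 0 y)); rewrite -(lprodDl lactP) !addr0. Qed.

Lemma lact0r (a : B K) : lact a 0 = 0 :> lpoly V.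
Proof. by apply: (addrI (lact a 0)); rewrite -(lprodDr lactP) !addr0. Qed.

(** Sesquilinearity produces the twist: in the inductions on [f] and [g], each ['X] contributes
    [- lambda] or [d + lambda]. *)
Lemma lact_basis i j (f g : {poly K}) n :
  (lact (f *: << i >> : B K) (g *: w j))@_n = (twist f g * p i j)`_n *: w (i + j).
Proof.
have shift (q : {poly {poly K}}) m : (lamP K * q)`_m =
    if m is m'.+1 then q`_m' else 0 by rewrite coefXM; case: m.
have twistCl1 b h : twist b%:P h = cstP b * twist 1 h by rewrite -twistCl mulr1.
have twistCr1 b h : twist h b%:P = cstP b * twist h 1 by rewrite -twistCr mulr1.
elim/poly_ind: f n => [|f b IHf] n.
  by rewrite scale0r lact0l mcoeff0 twist0l mul0r coef0 scale0r.
rewrite [f * 'X]mulrC scalerDl -scalerA (lprodDl lactP) mcoeffD.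
rewrite (lprodXl lactP) (lprodCl lactP) twistDl twistXl twistCl1.
rewrite !mulrDl coefD scalerDl; congr (_ + _).
  rewrite mulNr coefN scaleNr -mulrA shift; case: n => [|n] /=.
    by rewrite scale0r.
  by rewrite IHf.
rewrite -mulrA coefCM -scalerA; congr (_ *: _).
elim/poly_ind: g n {IHf} => [|g c IHg] n.
  by rewrite scale0r lact0r mcoeff0 twist0r mul0r coef0 scale0r.
rewrite [g * 'X]mulrC scalerDl -scalerA (lprodDr lactP) mcoeffD.
rewrite (lprodXr lactP) (lprodCr lactP) twistDr twistXr twistCr1.
rewrite !mulrDl !coefD !scalerDl; congr (_ + _ + _).
- by rewrite -mulrA coefCM -scalerA IHg.
- rewrite -mulrA shift; case: n => [|n] /=; first by rewrite scale0r.
  by rewrite IHg.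
by rewrite wp -mulrA coefCM scalerA /twist !rmorph1 !mul1r.
Qed.

Lemma graded_product_eq0 a v :
  (forall i j, p i j = 0) -> graded_product p a v = 0.
Proof.
move=> p0; apply: big1 => i _; apply: big1 => j _.
by rewrite p0 mulr0 basis_lpoly0.
Qed.

Local Opaque graded_product basis_lpoly.

Lemma combination_act a v n :
  combination (graded_product p a v)@_n = (lact (a : B K) (combination v))@_n.
Proof.
elim/malg_ind: a => [|a b IHa IHb|f i].
- by rewrite graded_product0l mcoeff0 raddf0 lact0l mcoeff0.
- rewrite (lprodDl lactP) mcoeffD -IHa -IHb -[RHS]linearD.
  by congr combination; rewrite (graded_productDl p a b); apply: mcoeffD.
elim/malg_ind: v => [|v x IHv IHx|g j].
- by rewrite graded_product0r mcoeff0 raddf0 lact0r mcoeff0.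
- rewrite linearD (lprodDr lactP) mcoeffD -IHv -IHx -[RHS]linearD.
  by congr combination; rewrite (graded_productDr p _ v); apply: mcoeffD.
rewrite graded_productU basis_lpolyE !combinationU.
by rewrite -lact_basis freeZ_scaleU mulr1.
Qed.

Lemma acts_by_neq0 : ~ trivial_module V -> exists i j, p i j != 0.
Proof.
move=> nt; apply: contrapT => p0; apply: nt => a y.
have {}p0 i j : p i j = 0.
  by apply/eqP/negPn/negP => ij; apply: p0; exists i, j.
have [v <-] := combination_surj y.
apply/malgP => n; rewrite -combination_act mcoeff0.
by rewrite graded_product_eq0 // mcoeff0 raddf0.
Qed.

Lemma acts_by_iso (HJ : lambda_jacobi (graded_product (@B_coef K))
  (graded_product p)) :
  module_iso V (@ConformalModule K (B K) _ _ (graded_product_is_lambda_product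
    p) HJ).
Proof.
have [g gK] := choice combination_surj.
have gK' : cancel combination g by move=> x; apply: combination_inj; rewrite gK.
have glin : linear g.
  by move=> f x y; apply: combination_inj; rewrite linearP /= !gK.
pose phi : {linear V -> freeZ K} := HB.pack g (GRing.isLinear.Build _ _ _ _ g
  glin).
exists phi; split; first by exists combination.
move=> a y n; apply: combination_inj.
by rewrite /= gK combination_act gK.
Qed.

(** The module axiom of [V] is pulled back along the injective [combination], then collected as in
    [graded_product_jacobi], of which this is the converse. *)
Lemma acts_by_jacobi_coefs i j k m n :
  (ev (- (ll K + mm K)) (ll K) (B_coef K i j) * ev (dd K) (ll K + mm K) (p (i +
    j) k))`_n`_m =
  (ev (dd K) (ll K) (p i (j + k)) * ev (dd K + ll K) (mm K) (p j k) -
   ev (dd K) (mm K) (p j (i + k)) * ev (dd K + mm K) (ll K) (p i k))`_n`_m.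
Proof.
have J := @lact_jacobi K (B K) V << i >> << j >> (combination << k >>) m n.
have {J} : \sum_(0 <= l < m.+1) (graded_product p
      (graded_product (@B_coef K) << i >> << j >>)@_l << k >>)@_(m - l + n)%N
      *+ 'C(m - l + n, n) =
    (graded_product p << i >> (graded_product p << j >> << k >>)@_n)@_m -
    (graded_product p << j >> (graded_product p << i >> << k >>)@_m)@_n.
  apply: combination_inj.
  rewrite [LHS]raddf_sum.
  rewrite [RHS]raddfB.
  rewrite [X in _ = X - _]combination_act.
  rewrite [X in _ = _ - X]combination_act.
  rewrite [in X in _ = X - _]combination_act.
  rewrite [in X in _ = _ - X]combination_act.
  rewrite -[RHS]J.
  apply: eq_bigr => l _.
  rewrite [LHS]raddfMn.
  by congr (_ *+ _); exact: combination_act.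
have tw1 : twist 1 1 = 1 :> {poly {poly K}} by rewrite /twist !rmorph1 mulr1.
rewrite !graded_productU !basis_lpolyE !graded_productU !basis_lpolyE.
rewrite (addrCA j i k) !addrA.
rewrite coef_act_lm coef_act_ml -raddfB -!coefB.
under eq_bigr => l _.
  rewrite basis_lpolyE graded_productU basis_lpolyE -raddfMn /=.
  over.
rewrite -raddf_sum coef_act_bracket tw1 !mul1r !rmorph1 !mul1r !mulr1.
move/(congr1 (fun x : freeZ K => x@_(i + j + k))).
by rewrite !mcoeffUU.
Qed.

Lemma acts_by_jacobi : jacobi_coef p.
Proof.
move=> i j k l m d.
pose at_l : {rmorphism {poly {poly K}} -> {poly K}} := horner_eval l%:P.
pose at_m : {rmorphism P3 K -> {poly {poly K}}} := horner_eval m%:P%:P.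
pose E : {rmorphism P3 K -> K} := horner_eval d \o (at_l \o at_m).
have E_ev (x y : P3 K) (q : {poly {poly K}}) : E (ev x y q) = q.[(E y)%:P].[E x].
  pose at_y : {rmorphism {poly {poly K}} -> {poly K}} := horner_eval (E y)%:P.
  apply: (@ev_ext _ _ (E \o ev x y) (horner_eval (E x) \o at_y)) => [c||].
  - by rewrite -[LHS]/(E (ev x y (cstP c))) evC /= /horner_eval /cstP !hornerC.
  - rewrite -[LHS]/(E (ev x y (derP K))) evd -[RHS]/((derP K).[(E y)%:P].[E x]).
    by rewrite /derP hornerC hornerX.
  rewrite -[LHS]/(E (ev x y (lamP K))) evl -[RHS]/((lamP K).[(E y)%:P].[E x]).
  by rewrite /lamP hornerX hornerC.
have El : E (ll K) = l by rewrite /E /= /horner_eval /ll hornerC hornerX hornerC.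
have Em : E (mm K) = m by rewrite /E /= /horner_eval /mm hornerX !hornerC.
have Ed : E (dd K) = d by rewrite /E /= /horner_eval /dd !hornerC hornerX.
have H : ev (- (ll K + mm K)) (ll K) (B_coef K i j)
    * ev (dd K) (ll K + mm K) (p (i + j) k) =
  ev (dd K) (ll K) (p i (j + k)) * ev (dd K + ll K) (mm K) (p j k) -
  ev (dd K) (mm K) (p j (i + k)) * ev (dd K + mm K) (ll K) (p i k).
  by apply/polyP => n; apply/polyP => n'; apply: acts_by_jacobi_coefs.
have := congr1 E H; rewrite rmorphB !rmorphM !E_ev !rmorphD rmorphN rmorphD El
  Em Ed.
move=> <-; congr (_ * _).
(* [i d + (i + j) lambda] at [d = - (l + m)], [lambda = l] is [j l - i m]. *)
rewrite /B_coef /intP /derP /lamP /cstP.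
rewrite !(hornerD, hornerM, hornerC, hornerX) rmorphD /=; ring.
Qed.

End Coordinates.

(** A rescaling of the coefficients is a change of homogeneous basis in the same module. *)
Theorem graded_basis_iso G w p q
    (HJ : lambda_jacobi (graded_product (@B_coef K)) (graded_product q)) :
  graded_basis G w -> acts_by w p -> rescaling p q ->
  module_iso V
    (@ConformalModule K (B K) _ _ (graded_product_is_lambda_product q) HJ).
Proof.
move=> wG wp [s [c [c0 cE]]].
apply: (acts_by_iso (graded_basis_rescale s wG c0)) => i j n.
rewrite (lprodCr (@lact_product K (B K) V)) wp !scalerA addrA; congr (_ *: _).
have := congr1 (fun u : {poly {poly K}} => u`_n) (cE i j).
by rewrite /= !coefCM => <-; rewrite mulrC.
Qed.

End GradedBases.

(** * The classification of modules in characteristic 0 *)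

Theorem free_intermediate_series_classification (K : fieldType)
    (V : conformalModule (B K)) :
  [pchar K] =i pred0 -> free_intermediate_series V -> ~ trivial_module V ->
  [\/ exists C D, module_iso V (V_CD C D),
     exists D, module_iso V (V_D D) | exists D, module_iso V (V'_D D)].
Proof.
move=> K0 [G [gG actG gen]] nt.
have [w wG] := choice gen.
have [p wp] := acts_by_exists (conj gG wG) actG.
have pJ := acts_by_jacobi (conj gG wG) wp.
have p0 := acts_by_neq0 (conj gG wG) wp nt.
have [[C [D r]]|[D r]|[D r]] := classification K0 pJ p0.
- by constructor 1; exists C, D; apply: graded_basis_iso (conj gG wG) wp r.
- by constructor 2; exists D; apply: graded_basis_iso (conj gG wG) wp r.
by constructor 3; exists D; apply: graded_basis_iso (conj gG wG) wp r.
Qed.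

Theorem theorem1p2 (R : realType) (V : conformalModule (B R[i])) :
  free_intermediate_series V -> ~ trivial_module V ->
  (exists C D : R[i], module_iso V (V_CD C D)) \/
  (exists D : R[i], module_iso V (V_D D)) \/
  (exists D : R[i], module_iso V (V'_D D)).
Proof.
move=> fV ntV.
have [||] := free_intermediate_series_classification (@Num.Theory.pchar_num _)
  fV ntV.
- by left.
- by right; left.
- by right; right.
Qed.
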